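(* Let $C$ be a random vector in $\mathbb{R}_+^n$ satisfying the asymptotic homogeneity assumption (stated in the context) with exponent $\alpha$ and function $h$, and let $\mu$ be the probability measure on $\mathcal{C}$ that is the weak limit, as $K\to\infty$, of the distributions of $\Psi_K=K^{\frac1{n+\alpha}}\min\{\ell_1,\dots,\ell_K\}$, where $\ell_1,\ell_2,\dots$ are independent copies of $\ell(p)=\langle C,p\rangle$, $p\in\overline{\Delta}_n$. Then for every $\psi\in\mathcal{C}$ the tail probability $\mathsf{T}_\mu(\psi):=\mu\{\omega\in\mathcal{C}:\omega\ge\psi\}$ satisfies $$\mathsf{T}_\mu(\psi)=\exp\Big(-\int_{\widehat{R}(\psi)}h(x)\,dx\Big).$$
   Context: Let $n\ge2$, $\mathbb{R}_+^n:=(0,\infty)^n$, $\Delta_n:=\{p\in(0,1)^n:p_1+\cdots+p_n=1\}$, $\overline{\Delta}_n$ its closure, $\langle p,x\rangle=\sum_ip_ix_i$. $\mathcal{C}:=\{\psi:\overline{\Delta}_n\to[0,\infty)\text{ continuous and concave}\}$ carries the (metrizable) topology of uniform convergence on compact subsets of $\Delta_n$ and its Borel $\sigma$-algebra. For $p\in\Delta_n$ and $a\ge0$, $R(p,a):=\{x\in\mathbb{R}_+^n:\langle p,x\rangle<a\}$ (empty if $a=0$). For $\psi\in\mathcal{C}$, $\widehat{R}(\psi):=\bigcup_{p\in\Delta_n}R(p,\psi(p))\subset\mathbb{R}_+^n$. The integral may be $+\infty$, with $e^{-\infty}=0$. Asymptotic homogeneity assumption: $C=(C_1,\dots,C_n)$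 has a joint density $\rho$ on $\mathbb{R}_+^n$, and there exist $\alpha\in\mathbb{R}$ and a non-negative measurable function $h$ on $\mathbb{R}_+^n$ with $\int_{\mathbb{R}_+^n}h(x)\,dx\in(0,\infty]$ such that $\lim_{\kappa\to0^+}\kappa^{-\alpha}\rho(\kappa x)=h(x)$ for $x\in\mathbb{R}_+^n$, uniformly for $x\in\Delta_n$. Under this assumption $\alpha>-n$ and the weak limit $\mu$ exists. *)

(* Defs.v *)
From HB Require Import structures.
From mathcomp Require Import all_boot all_order all_algebra.
From mathcomp Require Import finmap.
From mathcomp Require Import all_classical all_reals all_analysis.

Set Implicit Arguments.
Unset Strict Implicit.
Unset Printing Implicit Defensive.
Import Order.TTheory GRing.Theory Num.Theory.
Import numFieldNormedType.Exports.
Local Open Scope classical_set_scope.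
Local Open Scope ring_scope.

(* The coordinate sigma-algebra on R^n, i.e. the one [n.-tuple R] carries in the
   library; it coincides with the Borel sigma-algebra of 'rV[R]_n. *)
Section measurable_rV.
Context {R : realType}.
Variable n : nat.

Let coord (i : 'I_n) (x : 'rV[R]_n) : R := x 0 i.

Let rV_set0 : g_sigma_preimage coord set0.
Proof. exact: sigma_algebra0. Qed.

Let rV_setC A : g_sigma_preimage coord A -> g_sigma_preimage coord (~` A).
Proof. exact: sigma_algebraC. Qed.

Let rV_bigcup (F : (set 'rV[R]_n)^nat) :
  (forall i, g_sigma_preimage coord (F i)) ->
  g_sigma_preimage coord (\bigcup_i (F i)).
Proof. exact: sigma_algebra_bigcup. Qed.

HB.instance Definition _ := @isMeasurable.Build
  (measure_tuple_display default_measure_display)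
  'rV[R]_n (g_sigma_preimage coord) rV_set0 rV_setC rV_bigcup.

End measurable_rV.

Lemma measurable_coord {R : realType} n (i : 'I_n) :
  measurable_fun [set: 'rV[R]_n] (fun x : 'rV[R]_n => x 0 i : R).
Proof.
move=> _ Y mY; rewrite setTI; apply: sub_sigma_algebra => /=.
rewrite -bigcup_seq/=; exists i => /=; first by rewrite mem_index_enum.
by exists Y => //; rewrite setTI.
Qed.

Lemma measurable_fun_rVP {R : realType} d (T : measurableType d) n
    (f : T -> 'rV[R]_n) :
  measurable_fun [set: T] f <->
  forall i, measurable_fun [set: T] (fun x => f x 0 i : R).
Proof.
split=> [mf i|mf].
  exact: (measurableT_comp (@measurable_coord R n i) mf).
have /= := @g_sigma_preimage_comp _ R n _ (fun i (x : 'rV[R]_n) => x 0 i) T f.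
move=> E _ A mA; have : preimage_set_system setT f measurable (setT `&` f @^-1` A).
  by exists A.
rewrite -E; move: (setT `&` _); apply: smallest_sub.
  exact: sigma_algebra_measurable.
rewrite -bigcup_seq => B [i _ [C mC <-]]; exact: mf.
Qed.

Section lebesgue_rV.
Context {R : realType}.

Let cons_rV n (u : R * 'rV[R]_n) : 'rV[R]_n.+1 :=
  row_mx (const_mx u.1 : 'rV[R]_1) u.2.

Let cons_rV0 n (u : R * 'rV[R]_n) : cons_rV u 0 0 = u.1.
Proof.
rewrite (_ : 0 = lshift n 0 :> 'I_(1 + n)); last exact/val_inj.
by rewrite (@row_mxEl R 1 1 n) mxE.
Qed.

Let cons_rVS n (u : R * 'rV[R]_n) i : cons_rV u 0 (lift 0 i) = u.2 0 i.
Proof.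
rewrite (_ : lift 0 i = rshift 1 i :> 'I_(1 + n)); last exact/val_inj.
by rewrite (@row_mxEr R 1 1 n).
Qed.

Let measurable_cons_rV n : measurable_fun setT (@cons_rV n).
Proof.
apply/measurable_fun_rVP => i; case: (unliftP 0 i) => [j ->|->].
  under eq_fun do rewrite cons_rVS.
  exact: (measurableT_comp (@measurable_coord R n j) measurable_snd).
by under eq_fun do rewrite cons_rV0; exact: measurable_fst.
Qed.

Section step.
Variables (n : nat) (mu : {sigma_finite_measure set 'rV[R]_n -> \bar R}).

Let leb_mu := (@lebesgue_measure R \x mu)%E.
Let nu (A : set 'rV[R]_n.+1) : \bar R := leb_mu (@cons_rV n @^-1` A).

Let mpre (A : set 'rV[R]_n.+1) :
  measurable A -> measurable (@cons_rV n @^-1` A).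
Proof. by move=> mA; rewrite -[X in measurable X]setTI; exact: measurable_cons_rV. Qed.

Let nu0 : nu set0 = 0%E.
Proof. by rewrite /nu preimage_set0 /leb_mu measure0. Qed.

Let nu_ge0 A : (0 <= nu A)%E.
Proof. exact: measure_ge0. Qed.

Let nu_sigma_additive : semi_sigma_additive nu.
Proof.
move=> F mF tF mUF; rewrite /nu preimage_bigcup.
apply: measure_semi_sigma_additive.
- by move=> k; exact: mpre.
- apply/trivIsetP => /= i j _ _ ij; rewrite -preimage_setI.
  by move/trivIsetP : tF => /(_ _ _ _ _ ij) ->//; rewrite preimage_set0.
- by rewrite -preimage_bigcup; exact: mpre.
Qed.

HB.instance Definition _ := isMeasure.Build _ _ _ nu nu0 nu_ge0 nu_sigma_additive.

Let uncons (x : 'rV[R]_n.+1) : R * 'rV[R]_n :=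
  (x 0 0, \row_i x 0 (lift 0 i)).

Let unconsK : cancel (@cons_rV n) uncons.
Proof.
move=> [a v]; rewrite /uncons cons_rV0; congr pair.
by apply/rowP => i; rewrite mxE cons_rVS.
Qed.

Let measurable_uncons : measurable_fun setT uncons.
Proof.
apply: measurable_fun_pair; first exact: measurable_coord.
apply/measurable_fun_rVP => i.
under eq_fun do rewrite mxE.
exact: measurable_coord.
Qed.

Let nu_sigma_finite : sigma_finite setT nu.
Proof.
have /sigma_finiteP[F [TF ndF mF]] := sigma_finiteT (@lebesgue_measure R).
have /sigma_finiteP[G [TG ndG mG]] := sigma_finiteT mu.
have mFG k : measurable (F k `*` G k).
  by apply: measurableX; [exact: (mF k).1|exact: (mG k).1].
exists (fun k => uncons @^-1` (F k `*` G k)).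
  apply/seteqP; split=> // x _.
  have [i _ Fi] : (\bigcup_i F i) (uncons x).1 by rewrite -TF.
  have [j _ Gj] : (\bigcup_i G i) (uncons x).2 by rewrite -TG.
  exists (maxn i j) => //; split.
  - by move: Fi; exact/subsetPset/ndF/leq_maxl.
  - by move: Gj; exact/subsetPset/ndG/leq_maxr.
move=> k; split.
  by rewrite -[X in measurable X]setTI; apply: measurable_uncons => //; exact: mFG.
rewrite /nu -comp_preimage (_ : _ \o _ = id) ?preimage_id; last first.
  by apply/funext => u; exact: unconsK.
rewrite /leb_mu product_measure1E; last 2 first.
- exact: (mF k).1.
- exact: (mG k).1.
by have [? ?] := mF k; have [? ?] := mG k; rewrite lte_mul_pinfty// ge0_fin_numE.
Qed.

HB.instance Definition _ :=
  Measure_isSigmaFinite.Build _ _ _ nu nu_sigma_finite.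

Definition lebesgue_rV_step : {sigma_finite_measure set 'rV[R]_n.+1 -> \bar R} :=
  nu.

Lemma lebesgue_rV_step_setX (B : set R) (C : set 'rV[R]_n) :
  measurable B -> measurable C ->
  lebesgue_rV_step
    [set x | B (x 0 0) /\ C (\row_i x 0 (lift 0 i))] =
  (lebesgue_measure B * mu C)%E.
Proof.
move=> mB mC.
rewrite -(@product_measure1E _ _ _ _ _ (@lebesgue_measure R) mu B C)//.
rewrite /lebesgue_rV_step /= /nu /leb_mu; congr (_ _).
have E a (v : 'rV[R]_n) : \row_i cons_rV (a, v) 0 (lift 0 i) = v.
  by apply/rowP => i; rewrite mxE cons_rVS.
by apply/seteqP; split=> -[a v] /=; rewrite cons_rV0 E.
Qed.

End step.

(* n-dimensional Lebesgue measure, as an iterated product of [lebesgue_measure];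
   [lebesgue_rV_box] below gives its value on measurable boxes. *)
Fixpoint lebesgue_rV n : {sigma_finite_measure set 'rV[R]_n -> \bar R} :=
  if n is m.+1 then lebesgue_rV_step (lebesgue_rV m)
  else \d_(0 : 'rV[R]_0).

Lemma measurable_rV_box n (A : 'I_n -> set R) :
  (forall i, measurable (A i)) ->
  measurable [set x : 'rV[R]_n | forall i, A i (x 0 i)].
Proof.
move=> mA.
have -> : [set x : 'rV[R]_n | forall i, A i (x 0 i)] =
    \bigcap_(i in [set: 'I_n]) [set x | A i (x 0 i)].
  by apply/seteqP; split=> x Ax i //=; exact: Ax.
apply: fin_bigcap_measurable => // i _.
by rewrite -[X in measurable X]setTI; apply: measurable_coord => //; exact: mA.
Qed.

Lemma lebesgue_rV_box n (A : 'I_n -> set R) :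
  (forall i, measurable (A i)) ->
  lebesgue_rV n [set x : 'rV[R]_n | forall i, A i (x 0 i)] =
  (\prod_(i < n) lebesgue_measure (A i))%E.
Proof.
elim: n A => [|n IH] A mA.
  rewrite big_ord0 /= diracE.
  by rewrite mem_set// => -[].
rewrite big_ord_recl -IH; last by move=> i; exact: mA.
rewrite -lebesgue_rV_step_setX//; last first.
  exact: (@measurable_rV_box n (fun i => A (lift ord0 i)) (fun i => mA _)).
rewrite /=; congr (_ _); apply/seteqP; split=> x /=.
  by move=> Ax; split=> // i; rewrite mxE.
move=> [A0 AS] i; case: (unliftP 0 i) => [j ->|->] //.
by have := AS j; rewrite mxE.
Qed.

End lebesgue_rV.

Definition Rplus {R : realType} n : set 'rV[R]_n :=
  [set x | forall i, 0 < x 0 i].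
Arguments Rplus {R} n.

Definition simplex {R : realType} n : set 'rV[R]_n :=
  [set p | (forall i, 0 < p 0 i < 1) /\ \sum_i p 0 i = 1].
Arguments simplex {R} n.

Definition closed_simplex {R : realType} n : set 'rV[R]_n :=
  closure (simplex n).
Arguments closed_simplex {R} n.

Definition dotp {R : realType} n (p x : 'rV[R]_n) : R :=
  \sum_i p 0 i * x 0 i.

Lemma closed_simplex_ge0 {R : realType} n (p : 'rV[R]_n) i :
  closed_simplex n p -> 0 <= p 0 i.
Proof.
move=> cp; pose f (q : 'rV[R]_n) : R := q 0 i.
have cl : closed (f @^-1` [set x | 0 <= x]).
  apply: closed_comp => [x _|]; first exact: coord_continuous.
  exact: closed_ge.
apply: cl; apply: closure_subset cp => q [/(_ i)/andP[q0 _] _] /=.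
exact: ltW.
Qed.

Lemma dotp_continuous {R : realType} n (x : 'rV[R]_n) :
  continuous (fun p : 'rV[R]_n => dotp p x).
Proof.
apply: continuous_big => [|i _ p]; first exact: add_continuous.
apply: continuousM; last exact: cst_continuous.
exact: (@coord_continuous R 1 n 0 i p).
Qed.

Section concave_functions.
Variables (R : realType) (n : nat).

(* [r] ranges over points of the simplex rather than being the combination of
   [p] and [q] because [f] is only defined on the (convex) closed simplex. *)
Definition concave (f : closed_simplex n -> R) :=
  forall (t : R) (p q r : closed_simplex n), 0 <= t <= 1 ->
    \val r = t *: \val p + (1 - t) *: \val q ->
    t * f p + (1 - t) * f q <= f r.

Definition simplex_compacts : set (set (@closed_simplex R n)) :=
  [set K : set (closed_simplex n) |
    compact K /\ K `<=` [set p | simplex n (\val p)]].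

Definition concave_set :
    set {family simplex_compacts, @closed_simplex R n -> R} :=
  [set f | [/\ continuous (f : closed_simplex n -> R), concave f &
               forall p, 0 <= f p]].

Definition conc_fun := set_type concave_set.

(* The subspace topology of {family simplex_compacts, _ -> _}, that is, uniform
   convergence on the compact subsets of the open simplex; see [conc_fun_cvgE]. *)
HB.instance Definition _ := Topological.on conc_fun.

Lemma conc_fun_cvgE (F : set_system conc_fun) (f : conc_fun) : Filter F ->
  F --> f <->
  {family simplex_compacts, (fun g : conc_fun => \val g) @ F --> \val f}.
Proof.
move=> FF; split=> [Ff|H A [B [[C oC <-] Cf] BA]].
  apply: cvg_trans (cvg_fmap2 Ff) _.
  exact: (@initial_continuous _
    {family simplex_compacts, @closed_simplex R n -> R} (\val : conc_fun -> _) f).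
have : F (\val @^-1` C) by apply: H; exact: open_nbhs_nbhs.
by apply: filterS.
Qed.

Definition conc_fun_apply (psi : conc_fun) (p : closed_simplex n) : R :=
  \val psi p.
Coercion conc_fun_apply : conc_fun >-> Funclass.

Definition ConcFun (f : closed_simplex n -> R) (cf : continuous f)
    (ccf : concave f) (f0 : forall p, 0 <= f p) : conc_fun :=
  exist _ f (mem_set (And3 cf ccf f0)).

Lemma conc_fun_continuous (f : conc_fun) : continuous (f : closed_simplex n -> R).
Proof. by have [] := set_mem (valP f). Qed.

Lemma conc_fun_concave (f : conc_fun) : concave f.
Proof. by have [] := set_mem (valP f). Qed.

Lemma conc_fun_ge0 (f : conc_fun) p : 0 <= f p.
Proof. by have [_ _] := set_mem (valP f); exact. Qed.

Let zero_continuous : continuous ((fun=> 0) : @closed_simplex R n -> R).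
Proof. exact: cst_continuous. Qed.

Let zero_concave : concave (fun=> 0).
Proof. by move=> t p q r _ _; rewrite !mulr0 addr0. Qed.

HB.instance Definition _ := isPointed.Build conc_fun
  (ConcFun zero_continuous zero_concave (fun=> lexx 0)).

(* The Borel sigma-algebra. *)
HB.instance Definition _ := @isMeasurable.Build
  (sigma_display (@open conc_fun)) conc_fun <<s @open conc_fun >>
  (@sigma_algebra0 _ setT _) (@sigma_algebraC _ _)
  (@sigma_algebra_bigcup _ setT _).

Section linear.
Variables (x : 'rV[R]_n) (x0 : Rplus n x).
Let f (p : closed_simplex n) : R := dotp (\val p) x.

Let f_continuous : continuous f.
Proof.
have vc : continuous (\val : @closed_simplex R n -> 'rV[R]_n).
  exact: initial_continuous.
by move=> p; exact: (continuous_comp (vc p) (@dotp_continuous R n x _)).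
Qed.

Let f_concave : concave f.
Proof.
move=> t p q r _; rewrite /f => ->; rewrite /dotp !mulr_sumr -big_split /=.
by apply: ler_sum => i _; rewrite !mxE [leRHS]mulrDl !mulrA lexx.
Qed.

Let f_ge0 p : 0 <= f p.
Proof.
apply: sumr_ge0 => i _; apply: mulr_ge0; last exact: ltW.
by apply: closed_simplex_ge0; apply: set_mem; exact: (valP p).
Qed.

Definition conc_linear : conc_fun := ConcFun f_continuous f_concave f_ge0.

End linear.

Section min.
Variables f g : conc_fun.
Let m (p : closed_simplex n) : R := Num.min (f p) (g p).

Let m_continuous : continuous m.
Proof. by move=> p; apply: continuous_min; exact: conc_fun_continuous. Qed.

Let m_concave : concave m.
Proof.
move=> t p q r t01 rE; have /andP[t0 t1] := t01.
have t1' : 0 <= 1 - t by rewrite subr_ge0.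
rewrite /m le_min; apply/andP; split.
- apply: le_trans (@conc_fun_concave f _ _ _ _ t01 rE).
  by apply: lerD; apply: ler_wpM2l => //; rewrite ge_min lexx.
- apply: le_trans (@conc_fun_concave g _ _ _ _ t01 rE).
  by apply: lerD; apply: ler_wpM2l => //; rewrite ge_min lexx orbT.
Qed.

Let m_ge0 p : 0 <= m p.
Proof. by rewrite /m le_min !conc_fun_ge0. Qed.

Definition conc_min : conc_fun := ConcFun m_continuous m_concave m_ge0.

End min.

Section scale.
Variables (a : R) (a0 : 0 <= a) (f : conc_fun).
Let h (p : closed_simplex n) : R := a * f p.

Let h_continuous : continuous h.
Proof.
move=> p; apply: continuousM; first exact: cst_continuous.
exact: conc_fun_continuous.
Qed.

Let h_concave : concave h.
Proof.
move=> t p q r t01 rE; rewrite /h !(mulrCA _ a) -mulrDr.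
by apply: ler_wpM2l => //; exact: (@conc_fun_concave f _ _ _ _ t01 rE).
Qed.

Let h_ge0 p : 0 <= h p.
Proof. by rewrite /h mulr_ge0 ?conc_fun_ge0. Qed.

Definition conc_scale : conc_fun := ConcFun h_continuous h_concave h_ge0.

End scale.

(* The neutral element [l 0] of the iterated minimum is one of the terms as soon
   as [0 < K], so that this is K^s * min (l 0, ..., l (K - 1)). *)
Definition scaled_min (s : R) (l : nat -> conc_fun) (K : nat) : conc_fun :=
  conc_scale (powR_ge0 K%:R s) (\big[conc_min/l 0]_(k < K) l k).

Lemma scaled_minE s l K p :
  scaled_min s l K p = K%:R `^ s * \big[Num.min/l 0 p]_(k < K) l k p.
Proof.
rewrite /scaled_min /conc_fun_apply /=; congr (_ * _).
exact: (big_morph (fun f : conc_fun => f p) (fun _ _ => erefl) erefl).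
Qed.

Definition Rpa (p : 'rV[R]_n) (a : R) : set 'rV[R]_n :=
  [set x | Rplus n x /\ dotp p x < a].

Definition Rhat (psi : conc_fun) : set 'rV[R]_n :=
  \bigcup_(p in [set p : closed_simplex n | simplex n (\val p)])
    Rpa (\val p) (psi p).

Definition tail_prob (mu : set conc_fun -> \bar R) (psi : conc_fun) : \bar R :=
  mu [set omega : conc_fun | forall p, psi p <= omega p].

(* Convergence of the integrals of bounded continuous functions. *)
Definition weak_limit (nu : nat -> set conc_fun -> \bar R)
    (mu : set conc_fun -> \bar R) :=
  forall f : conc_fun -> R, continuous f ->
    (exists M, forall omega, `|f omega| <= M) ->
    (\int[nu K]_omega (f omega)%:E)%E @[K --> \oo] -->
      (\int[mu]_omega (f omega)%:E)%E.

End concave_functions.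

(* Mutual independence: the product rule for every finite subfamily. *)
Definition independent_RVs {R : realType} d d' (Omega : measurableType d)
    (T : measurableType d') (P : probability Omega R) (X : nat -> {RV P >-> T}) :=
  forall (J : {fset nat}) (A : nat -> set T), (forall k, measurable (A k)) ->
    P (\bigcap_(k in [set` J]) (X k @^-1` A k)) =
    (\prod_(k <- J) P (X k @^-1` A k))%E.

Definition has_density {R : realType} d (Omega : measurableType d) n
    (P : probability Omega R) (C : {RV P >-> 'rV[R]_n}) (rho : 'rV[R]_n -> R) :=
  [/\ measurable_fun (Rplus n) rho,
      forall x, Rplus n x -> 0 <= rho x &
      forall A, measurable A ->
        P (C @^-1` A) = (\int[lebesgue_rV n]_(x in A `&` Rplus n) (rho x)%:E)%E].

Definition asymptotically_homogeneous {R : realType} d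
    (Omega : measurableType d) n (P : probability Omega R)
    (C : {RV P >-> 'rV[R]_n}) (alpha : R) (h : 'rV[R]_n -> R) :=
  exists rho : 'rV[R]_n -> R,
  [/\ has_density C rho,
      measurable_fun (Rplus n) h /\ (forall x, Rplus n x -> 0 <= h x),
      (0 < \int[lebesgue_rV n]_(x in Rplus n) (h x)%:E)%E,
      forall x, Rplus n x ->
        kappa `^ (- alpha) * rho (kappa *: x) @[kappa --> 0^'+] --> h x &
      {uniform simplex n,
        (fun kappa x => kappa `^ (- alpha) * rho (kappa *: x)) @ 0^'+ --> h}].

(* Main.v *)
Require Import Defs.
From HB Require Import structures.
From mathcomp Require Import all_boot all_order all_algebra.
From mathcomp Require Import finmap.
From mathcomp Require Import all_classical all_reals all_analysis.
From mathcomp Require Import measurable_realfun ring lra.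

Set Implicit Arguments.
Unset Strict Implicit.
Unset Printing Implicit Defensive.
Import Order.TTheory GRing.Theory Num.Theory.
Import numFieldNormedType.Exports.
Local Open Scope classical_set_scope.
Local Open Scope ring_scope.

(** The law of the limit is determined by finitely many directions at a time.
    Fix points q_0, ..., q_(m-1) of the open simplex and heights
    a_k = psi (q_k).  The minimum of K independent copies of ell, rescaled by
    K^s with s = 1 / (n + alpha), lies above t a_k at every q_k exactly when
    none of the K copies of C falls into K^(-s) t B, where B is the bounded
    star-shaped set of those x in the orthant with <q_k, x> < a_k for some k
    ([cut]).  By independence this has probability
    (1 - P(C in t K^(-s) B))^K.

    Asymptotic homogeneity gives kappa^(-(n + alpha)) P(C in kappa B) -> L,
    L being the integral of h over B ([cut_prob_cvg]).  After the change of
    variables x = kappa y this is immediate on shells v B \ u B, which stay away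
    from 0 and infinity, so that kappa^(-alpha) rho (kappa y) converges
    uniformly there ([annulus_cvg]).  This convergence alone gives no control
    near 0, where the shells are added up through the relation
    phi (kappa) - phi (kappa / 2) ~ H kappa^(n + alpha) satisfied by
    phi (kappa) = P(C in kappa B), using phi (0+) = 0.  The shells also show
    that n + alpha > 0: otherwise all of them would have h-mass 0 and h would
    vanish almost everywhere ([exponent_gt0]).

    Hence the probabilities above converge to exp (- t^(n + alpha) L).  A
    continuous function squeezed between the indicators of two such events
    ([above_bump]) carries this over to mu, and t -> 1 yields
    mu (omega (q_k) >= a_k for k < m) = exp (- L) ([mu_above]).  Finally m grows
    along a countable set of q_k; both sides pass to the limit by monotone
    convergence.

    Non-negative concave functions are what makes a countable set sufficient:
    if z >= (1 - t) x coordinatewise then g z >= (1 - t) g x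
    ([concave_lower]).  So on the open simplex the logarithm of g is
    1-Lipschitz for the Thompson metric, and values at a dense set of points
    control g locally uniformly.  This identifies the events
    {omega >= psi} and the set Rhat psi with countable intersections and unions
    over the q_k, and it shows that the Borel sigma-algebra of the space of
    concave functions is generated by the evaluations at the q_k
    ([measurable_conc_fun]), so that the rescaled minima are measurable. *)

(** * Lebesgue measure under homotheties *)

Section lebesgue_scaling.
Context {R : realType}.

Lemma measurable_scale_rV n (c : R) :
  measurable_fun [set: 'rV[R]_n] (fun x : 'rV[R]_n => c *: x).
Proof.
apply/measurable_fun_rVP => i; under eq_fun do rewrite mxE.
by apply: measurable_funM => //; exact: measurable_coord.
Qed.

Lemma measurable_preimage_scale n (k : R) (S : set 'rV[R]_n) : measurable S ->
  measurable ((fun x => k *: x) @^-1` S).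
Proof. by move=> mS; rewrite -[X in measurable X]setTI; exact: measurable_scale_rV. Qed.

(** The measurability proof is an argument because unification cannot recover it
    from the function alone. *)
Definition push_measure d d' (T : measurableType d) (T' : measurableType d')
    (m : {measure set T -> \bar R}) (f : T -> T')
    (mf : measurable_fun [set: T] f) : {measure set T' -> \bar R} :=
  measure_function_pushforward__canonical__measure_function_Measure m mf.

Lemma push_measureE d d' (T : measurableType d) (T' : measurableType d')
    (m : {measure set T -> \bar R}) (f : T -> T')
    (mf : measurable_fun [set: T] f) A : push_measure m mf A = m (f @^-1` A).
Proof. by []. Qed.

Lemma lebesgue_measure_scale (c : R) (A : set R) : 0 < c -> measurable A ->
  lebesgue_measure ((fun x => c * x) @^-1` A) = (c^-1%:E * lebesgue_measure A)%E.
Proof.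
move=> c0 mA.
have mf : measurable_fun [set: measurableTypeR R]
    ((fun x => c * x) : measurableTypeR R -> measurableTypeR R).
  exact: measurable_funM.
pose m := mscale (NngNum (ltW c0)) (push_measure (@lebesgue_measure R) mf).
have mE X : m X = (c%:E * lebesgue_measure ((fun x => (c * x)%R) @^-1` X))%E by [].
have mI X : ocitv X -> lebesgue_measure X = m X.
  move=> [[a b] _ <-]; rewrite mE.
  have -> : (fun x => c * x) @^-1` `]a, b] = `]c^-1 * a, c^-1 * b]%classic.
    apply/seteqP; split=> x /=; rewrite !in_itv/= => /andP[xa xb];
     by apply/andP; split; move: xa xb; rewrite ?ltr_pdivrMl ?ler_pdivlMl.
  rewrite !lebesgue_measure_itv/= !lte_fin ltr_pM2l ?invr_gt0//.
  case: ifP => // _; last by rewrite mule0.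
  by rewrite -EFinD -EFinM -mulrBr mulVKf// gt_eqF.
have -> : lebesgue_measure A = m A by exact: lebesgue_measure_unique.
by rewrite mE muleA -EFinM mulVf ?gt_eqF// mul1e.
Qed.

(* A measure on n.+1 coordinates is compared with the product measure that
   defines [lebesgue_rV n.+1] through the splitting of a row into its first
   entry and the rest. *)
Let head_tail n (x : 'rV[R]_n.+1) : measurableTypeR R * 'rV[R]_n :=
  (x 0 0, \row_i x 0 (lift 0 i)).

Let head_tail_inv n (u : measurableTypeR R * 'rV[R]_n) : 'rV[R]_n.+1 :=
  \row_i (if unlift 0 i is Some j then u.2 0 j else u.1).

Let head_tailK n : cancel (@head_tail n) (@head_tail_inv n).
Proof.
move=> x; apply/rowP => i; rewrite mxE /=.
by case: unliftP => [j ->|->]; rewrite ?mxE.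
Qed.

Let measurable_head_tail n : measurable_fun setT (@head_tail n).
Proof.
apply: measurable_fun_pair; first exact: measurable_coord.
by apply/measurable_fun_rVP => i; under eq_fun do rewrite mxE;
  exact: measurable_coord.
Qed.

Let measurable_head_tail_inv n : measurable_fun setT (@head_tail_inv n).
Proof.
apply/measurable_fun_rVP => i; under eq_fun do rewrite mxE.
case: unliftP => [j _|_]; last exact: measurable_fst.
exact: (measurableT_comp (@measurable_coord R n j) measurable_snd).
Qed.

(** Through the splitting of a row, this is the uniqueness of the product of
    two sigma-finite measures. *)
Lemma lebesgue_rV_unique n (m : {measure set 'rV[R]_n.+1 -> \bar R}) :
  (forall (A : set R) (B : set 'rV[R]_n), measurable A -> measurable B ->
    m [set x | A (x 0 0) /\ B (\row_i x 0 (lift 0 i))] =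
    (lebesgue_measure A * lebesgue_rV n B)%E) ->
  forall X, measurable X -> lebesgue_rV n.+1 X = m X.
Proof.
move=> mE X mX.
have E (m' : {measure set 'rV[R]_n.+1 -> \bar R}) :
  (forall (A : set R) (B : set 'rV[R]_n), measurable A -> measurable B ->
    m' [set x | A (x 0 0) /\ B (\row_i x 0 (lift 0 i))] =
    (lebesgue_measure A * lebesgue_rV n B)%E) ->
  m' X = (@lebesgue_measure R \x lebesgue_rV n)%E (@head_tail_inv n @^-1` X).
  move=> m'E.
  transitivity (push_measure m' (@measurable_head_tail n)
      (@head_tail_inv n @^-1` X)).
    rewrite push_measureE; congr (m' _).
    by apply/seteqP; split=> x /=; rewrite head_tailK.
  apply/esym/product_measure_unique; last first.
    by rewrite -[X in measurable X]setTI; exact: measurable_head_tail_inv.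
  by move=> A B mA mB; rewrite push_measureE; exact: m'E.
rewrite (E m mE) E// => A B mA mB.
exact: lebesgue_rV_step_setX.
Qed.

(** By induction on n: rescaled back, the image measure has the value of a
    product on every rectangle, and rectangles determine the measure. *)
Lemma lebesgue_rV_scale n (c : R) (A : set 'rV[R]_n) : 0 < c -> measurable A ->
  lebesgue_rV n ((fun x => c *: x) @^-1` A) =
  ((c ^- n)%:E * lebesgue_rV n A)%E.
Proof.
move=> c0; elim: n A => [|n IH] A mA.
  rewrite expr0 invr1 mul1e /= !diracE; congr ((_ _)%:R%:E).
  by apply/idP/idP; rewrite !inE/= scaler0.
have cn0 : 0 <= c ^+ n.+1 by rewrite exprn_ge0// ltW.
pose m : {measure set 'rV[R]_n.+1 -> \bar R} := mscale (NngNum cn0)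
  (push_measure (lebesgue_rV n.+1) (@measurable_scale_rV n.+1 c)).
have mE X : m X = ((c ^+ n.+1)%:E *
  lebesgue_rV n.+1 ((fun x => c *: x) @^-1` X))%E by [].
have mI X : measurable X -> lebesgue_rV n.+1 X = m X.
  apply: lebesgue_rV_unique => {mA}A B mA mB; rewrite mE.
  have -> : (fun x : 'rV[R]_n.+1 => c *: x) @^-1`
      [set x | A (x 0 0) /\ B (\row_i x 0 (lift 0 i))] =
      [set x | ((fun x : R => c * x) @^-1` A) (x 0 0) /\
        ((fun x : 'rV[R]_n => c *: x) @^-1` B) (\row_i x 0 (lift 0 i))].
    have E (x : 'rV[R]_n.+1) :
        \row_i (c *: x) 0 (lift 0 i) = c *: \row_i x 0 (lift 0 i).
      by apply/rowP => i; rewrite !mxE.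
    by apply/seteqP; split=> x; rewrite /preimage/= E mxE.
  rewrite lebesgue_rV_step_setX; last 2 first.
  - by rewrite -[X in measurable X]setTI; exact: measurable_funM.
  - by rewrite -[X in measurable X]setTI; exact: measurable_scale_rV.
  rewrite IH// lebesgue_measure_scale//.
  move: (lebesgue_measure A) (lebesgue_rV n B) => a b.
  rewrite (muleACA c^-1%:E) -EFinM (muleA (c ^+ n.+1)%:E) -EFinM.
  rewrite -invfM -exprS mulfV ?mul1e// expf_neq0// gt_eqF//.
rewrite (mI _ mA) mE.
by rewrite muleA -EFinM mulVf ?mul1e// expf_neq0// gt_eqF.
Qed.

(** Change of variables for a homothety: the image of Lebesgue measure is a
    multiple of Lebesgue measure. *)
Lemma ge0_integral_scale_rV n (c : R) (A : set 'rV[R]_n) (f : 'rV[R]_n -> \bar R) :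
  0 < c -> measurable A -> measurable_fun A f -> (forall x, A x -> 0 <= f x)%E ->
  (\int[lebesgue_rV n]_(x in (fun x => c *: x) @^-1` A) f (c *: x) =
  (c ^- n)%:E * \int[lebesgue_rV n]_(x in A) f x)%E.
Proof.
move=> c0 mA mf f0.
have cn0 : 0 <= c ^- n by rewrite invr_ge0 exprn_ge0// ltW.
have -> : (\int[lebesgue_rV n]_(x in (fun x => c *: x) @^-1` A) f (c *: x) =
  \int[push_measure (lebesgue_rV n) (@measurable_scale_rV n c)]_(x in A) f x)%E.
  apply/esym/ge0_integral_pushforward => //; first exact: measurable_scale_rV.
  by move=> x /set_mem; exact: f0.
rewrite (@eq_measure_integral _ _ _ _ (mscale (NngNum cn0) (lebesgue_rV n))).
  by rewrite ge0_integral_mscale.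
move=> X mX _; rewrite push_measureE; exact: lebesgue_rV_scale.
Qed.

End lebesgue_scaling.

(** * Probabilities of small dilates *)

Section regular_variation.
Context {R : realType}.

Lemma at_right0P (Q : R -> Prop) :
  (\forall k \near 0^'+, Q k) <->
  exists2 d : R, 0 < d & forall k, 0 < k < d -> Q k.
Proof.
split=> [[d /= d0 H]|[d d0 H]].
  exists d => // k /andP[k0 kd]; apply: H => //=.
  by rewrite sub0r normrN gtr0_norm.
exists d => //= k /=; rewrite sub0r normrN => kd k0.
by apply: H; rewrite k0 /= -(gtr0_norm k0).
Qed.

Definition l1 n (x : 'rV[R]_n) : R := \sum_i x 0 i.

Lemma Rplus_scale n (c : R) (x : 'rV[R]_n) : 0 < c ->
  Rplus n (c *: x) <-> Rplus n x.
Proof.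
by move=> c0; split=> H i; move: (H i); rewrite mxE pmulr_rgt0.
Qed.

Lemma l1_scale n (c : R) (x : 'rV[R]_n) : l1 (c *: x) = c * l1 x.
Proof. by rewrite /l1 mulr_sumr; apply: eq_bigr => i _; rewrite mxE. Qed.

Lemma le_coord_l1 n (x : 'rV[R]_n) i : Rplus n x -> x 0 i <= l1 x.
Proof.
move=> x0; rewrite /l1 (bigD1 i)//= lerDl; apply: sumr_ge0 => j _.
exact: ltW.
Qed.

Lemma lt_coord_l1 n (x : 'rV[R]_n) i : (2 <= n)%N -> Rplus n x -> x 0 i < l1 x.
Proof.
move=> n2 x0; have [j ij] : exists j, j != i.
  have /card_gt1P[j [k [_ _ jk]]] : (1 < #|'I_n|)%N by rewrite card_ord.
  by have [ji|] := eqVneq j i; [exists k; rewrite -ji eq_sym|exists j].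
rewrite /l1 (bigD1 i)//= ltrDl (bigD1 j)//= ltr_pwDl//.
by apply: sumr_ge0 => k _; exact: ltW.
Qed.

Lemma l1_gt0 n (x : 'rV[R]_n) : (2 <= n)%N -> Rplus n x -> 0 < l1 x.
Proof.
move=> n2 x0; have i0 : 'I_n by exact: (Ordinal (ltnW n2)).
exact: lt_trans (x0 i0) (lt_coord_l1 _ n2 x0).
Qed.

Lemma simplex_normalize n (x : 'rV[R]_n) : (2 <= n)%N -> Rplus n x ->
  simplex n ((l1 x)^-1 *: x).
Proof.
move=> n2 x0; have s0 := l1_gt0 n2 x0; split; last first.
  by rewrite -[LHS]/(l1 _) l1_scale mulVf// gt_eqF.
move=> i; rewrite mxE mulr_gt0 ?invr_gt0//=.
by rewrite mulrC ltr_pdivrMr// mul1r lt_coord_l1.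
Qed.

Lemma measurable_Rplus n : measurable (@Rplus R n).
Proof.
rewrite (_ : Rplus n = [set x | forall i, [set y | 0 < y] (x 0 i)])//.
apply: (@measurable_rV_box R n (fun _ => [set y | 0 < y])) => i.
by rewrite -set_itvoy.
Qed.

Lemma measurable_dotp n (p : 'rV[R]_n) : measurable_fun setT (fun x => dotp p x).
Proof.
rewrite /dotp; apply: measurable_sum => i; apply: measurable_funM => //.
exact: measurable_coord.
Qed.

Lemma dotp_scale n (p x : 'rV[R]_n) c : dotp p (c *: x) = c * dotp p x.
Proof. by rewrite /dotp mulr_sumr; apply: eq_bigr => i _; rewrite mxE mulrCA. Qed.

Lemma dotp_le_l1 n (p x : 'rV[R]_n) : simplex n p -> Rplus n x -> dotp p x <= l1 x.
Proof.
move=> [p01 _] x0; apply: ler_sum => i _; have /andP[_ p1] := p01 i.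
by rewrite -[leRHS]mul1r ler_pM2r// ltW.
Qed.

(** Both endpoints occur because the power is increasing or decreasing
    according to the sign of the exponent. *)
Lemma powR_itv_le (c M r a : R) : 0 < c -> c <= r <= M ->
  r `^ a <= c `^ a + M `^ a.
Proof.
move=> c0 /andP[cr rM]; have r0 := lt_le_trans c0 cr.
have M0 := lt_le_trans r0 rM.
have [a0|a0] := leP 0 a.
  apply: (@le_trans _ _ (M `^ a)); last by rewrite lerDr powR_ge0.
  by apply: ge0_ler_powR; rewrite // nnegrE ltW.
apply: (@le_trans _ _ (c `^ a)); last by rewrite lerDl powR_ge0.
rewrite -(opprK a) !(powRN _ (- a)) lef_pV2 ?posrE ?powR_gt0//.
by apply: ge0_ler_powR; rewrite ?oppr_ge0// ?nnegrE ltW.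
Qed.

Lemma powRN_mul (k r alpha : R) : 0 < k -> 0 < r ->
  k `^ (- alpha) = r `^ alpha * (k * r) `^ (- alpha).
Proof.
move=> k0 r0; rewrite powRM ?ltW// mulrCA -powRD ?subrr ?powRr0 ?mulr1//.
by apply/implyP => _; rewrite gt_eqF.
Qed.

Section homogeneous.
Variables (n : nat) (n_ge2 : (2 <= n)%N).
Variables (d0 : measure_display) (Omega0 : measurableType d0).
Variables (P0 : probability Omega0 R) (C : {RV P0 >-> 'rV[R]_n}).
Variables (alpha : R) (h rho : 'rV[R]_n -> R).
Hypothesis C_density : has_density C rho.
Hypothesis h_meas : measurable_fun (Rplus n) h.
Hypothesis h_ge0 : forall x, Rplus n x -> 0 <= h x.
Hypothesis h_cvg : forall x, Rplus n x ->
  kappa `^ (- alpha) * rho (kappa *: x) @[kappa --> 0^'+] --> h x.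
Hypothesis h_unif : {uniform simplex n,
  (fun kappa x => kappa `^ (- alpha) * rho (kappa *: x)) @ 0^'+ --> h}.

Lemma unif_simplex (e : R) : 0 < e -> exists2 d : R, 0 < d &
  forall k x, 0 < k < d -> simplex n x ->
    `|k `^ (- alpha) * rho (k *: x) - h x| < e.
Proof.
move=> e0; have : \forall k \near 0^'+, forall x, simplex n x ->
    `|k `^ (- alpha) * rho (k *: x) - h x| < e.
  have := @h_unif [set f | forall x, simplex n x -> `|f x - h x| < e]; apply.
  apply/uniform_nbhs.
  exists [set z | `|z.2 - z.1| < e]; split; last by move=> f /= H x /H.
  exists e => //= -[y z] /=; rewrite /ball/= distrC; exact.
by move=> /at_right0P[d d_gt0 H]; exists d => // k x kd; exact: H.
Qed.

(** With r = l1 x and u = x / r, the quantity kappa^(-alpha) rho (kappa x) is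
    r^alpha times (kappa r)^(-alpha) rho (kappa r u); as kappa -> 0 the first
    tends to h x and the second factor to h u. *)
Lemma limit_homogeneous x : Rplus n x ->
  h x = l1 x `^ alpha * h ((l1 x)^-1 *: x).
Proof.
move=> x0; have r0 := l1_gt0 n_ge2 x0; set r := l1 x.
set u := r^-1 *: x; have su : simplex n u := simplex_normalize n_ge2 x0.
have xE : x = r *: u by rewrite /u scalerA mulfV ?gt_eqF// scale1r.
apply/eqP; rewrite -subr_eq0 -normr_le0; apply/ler_addgt0Pl => e e0.
rewrite addr0.
have e'0 : 0 < e / (1 + r `^ alpha) by rewrite divr_gt0// ltr_pwDl// powR_ge0.
have [d1 d10 H1] := unif_simplex e'0.
have /cvgrPdist_lt/(_ _ e'0)/at_right0P[d2 d20 H2] := h_cvg x0.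
pose k := Num.min (d1 / r) d2 / 2.
have k0 : 0 < k by rewrite divr_gt0// lt_min d20 divr_gt0.
have k1 : k * r < d1.
  rewrite -ltr_pdivlMr// /k ltr_pdivrMr//.
  apply: le_lt_trans (_ : _ <= d1 / r) _; rewrite ?ge_min ?lexx//.
  by rewrite ltr_pMr ?divr_gt0// ltr1n.
have k2 : k < d2.
  rewrite /k ltr_pdivrMr//.
  by apply: le_lt_trans (_ : _ <= d2) _; rewrite ?ge_min ?lexx ?orbT// ltr_pMr// ltr1n.
have := H2 k; rewrite k0 k2 => /(_ isT) {}H2.
have := H1 (k * r) u; rewrite mulr_gt0//= k1 => /(_ isT su) {}H1.
have kxE : k *: x = (k * r) *: u by rewrite -scalerA -xE.
move: H2 H1; rewrite kxE (powRN_mul alpha k0 r0) -mulrA.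
set z := _ `^ _ * rho _ => H2 H1.
rewrite (_ : _ - _ = (h x - r `^ alpha * z) + r `^ alpha * (z - h u)); last by ring.
apply: le_trans (ler_normD _ _) _; rewrite normrM (ger0_norm (powR_ge0 _ _)).
rewrite -[leRHS](@divfK _ (1 + r `^ alpha)) ?gt_eqF ?ltr_pwDl ?powR_ge0//.
rewrite mulrDr mulr1 lerD//; first exact: ltW.
by rewrite mulrC ler_wpM2r ?powR_ge0// ltW.
Qed.

(** Homogeneity in the radial direction spreads the uniformity on the simplex
    to an annulus, where the factor (l1 x)^alpha is bounded. *)
Lemma unif_annulus (c M e : R) : 0 < c -> 0 < M -> 0 < e -> exists2 d : R, 0 < d &
  forall k x, 0 < k < d -> Rplus n x -> c <= l1 x <= M ->
    `|k `^ (- alpha) * rho (k *: x) - h x| <= e.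
Proof.
move=> c0 M0 e0; set B := c `^ alpha + M `^ alpha.
have B0 : 0 < B by rewrite addr_gt0// powR_gt0.
have [d d_gt0 H] := unif_simplex (divr_gt0 e0 B0).
exists (d / M); first by rewrite divr_gt0.
move=> k x /andP[k0 kd] x0 cxM; have r0 := l1_gt0 n_ge2 x0.
have /andP[cx xM] := cxM.
have kr : 0 < k * l1 x < d.
  rewrite mulr_gt0//=; apply: le_lt_trans (_ : k * M < d).
    by rewrite ler_wpM2l// ltW.
  by rewrite -ltr_pdivlMr.
have := H _ _ kr (simplex_normalize n_ge2 x0).
rewrite scalerA mulfK ?gt_eqF// (limit_homogeneous x0) (powRN_mul alpha k0 r0).
rewrite -mulrA -mulrBr => {}H.
rewrite normrM (ger0_norm (powR_ge0 _ _)).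
apply: le_trans (_ : B * (e / B) <= _).
  apply: ler_pM; rewrite ?powR_ge0 ?normr_ge0//; last exact: ltW.
  exact: powR_itv_le.
by rewrite mulrC divfK// gt_eqF.
Qed.

Lemma annulus_finite (S : set 'rV[R]_n) (M : R) : measurable S ->
  S `<=` Rplus n -> (forall x, S x -> l1 x <= M) ->
  lebesgue_rV n S \is a fin_num.
Proof.
move=> mS SR SM.
have mI (i : 'I_n) : measurable (`[0, M]%classic : set R) by exact: measurable_itv.
rewrite ge0_fin_numE ?measure_ge0//.
apply: (@le_lt_trans _ _
  (lebesgue_rV n [set x : 'rV[R]_n | forall i, `[0, M]%classic (x 0 i)])).
  apply: le_measure; rewrite ?inE//; first exact: (measurable_rV_box mI).
  move=> x Sx i /=; rewrite in_itv/= (ltW (SR _ Sx i))/=.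
  exact: le_trans (le_coord_l1 _ (SR _ Sx)) (SM _ Sx).
rewrite (lebesgue_rV_box mI).
suff /fin_numPlt/andP[] : (\prod_(i < n) lebesgue_measure `[0%R, M])%E
  \is a fin_num by [].
elim/big_ind : _ => //; first by move=> x y; exact: fin_numM.
by move=> i _; rewrite lebesgue_measure_itv/=; case: ifP.
Qed.

Lemma density_scaled (S : set 'rV[R]_n) (k : R) : 0 < k -> measurable S ->
  S `<=` Rplus n ->
  ((k `^ (- (n%:R + alpha)))%:E *
    P0 (C @^-1` ((fun x => (k^-1 *: x)%R) @^-1` S)) =
  \int[lebesgue_rV n]_(x in S) (k `^ (- alpha) * rho (k *: x))%:E)%E.
Proof.
move=> k0 mS SR; have [mrho rho0 PE] := C_density.
set A := _ @^-1` S.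
have mA : measurable A by exact: measurable_preimage_scale.
have AR : A `<=` Rplus n by move=> x /SR; rewrite Rplus_scale// invr_gt0.
have mrhoA : measurable_fun A (EFin \o rho).
  by apply/measurable_EFinP; apply: measurable_funS mrho => //; exact: measurable_Rplus.
have SE : S = (fun x => k *: x) @^-1` A.
  apply/seteqP; split=> x /=; rewrite /A /preimage/= scalerA mulVf ?gt_eqF// scale1r//.
rewrite PE// setIidl// opprD addrC powRD; last by apply/implyP => _; rewrite gt_eqF.
rewrite (powRN k n%:R) powR_mulrn ?ltW// EFinM -muleA.
rewrite -(@ge0_integral_scale_rV _ _ _ _ (EFin \o rho))//; last first.
  by move=> x /AR /rho0; rewrite lee_fin.
rewrite -SE [RHS](_ : _ = \int[lebesgue_rV n]_(x in S)
  ((k `^ (- alpha))%:E * (rho (k *: x))%:E))%E//.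
rewrite ge0_integralZl_EFin ?powR_ge0//.
- by move=> x Sx; rewrite lee_fin rho0// Rplus_scale//; exact: SR.
- apply/measurable_EFinP; apply: (@measurable_comp _ _ _ _ _ _ A) => //.
  + by move=> x [y]; rewrite SE => Ay <-.
  + exact/measurable_EFinP.
  + by apply: measurable_funTS; exact: measurable_scale_rV.
Qed.

(** By [density_scaled] the rescaled probability is the integral over S of
    kappa^(-alpha) rho (kappa x), and S has finite volume, so uniform
    convergence of the integrands gives convergence of the integrals.  Finiteness
    of the limit comes along, the approximating integrals being finite. *)
Lemma annulus_cvg (S : set 'rV[R]_n) (c M : R) : 0 < c -> 0 < M ->
  measurable S -> S `<=` Rplus n -> (forall x, S x -> c <= l1 x <= M) ->
  exists2 H : R, (\int[lebesgue_rV n]_(x in S) (h x)%:E = H%:E)%E &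
  forall e : R, 0 < e -> exists2 d : R, 0 < d & forall k, 0 < k < d ->
    `|k `^ (- (n%:R + alpha)) *
      fine (P0 (C @^-1` ((fun x => k^-1 *: x) @^-1` S))) - H| <= e.
Proof.
move=> c0 M0 mS SR ScM; have [mrho rho0 PE] := C_density.
have /fineK : lebesgue_rV n S \is a fin_num.
  by apply: (@annulus_finite _ M) => // x /ScM/andP[].
set V := fine _ => VE.
have V0 : 0 <= V by rewrite fine_ge0.
have PfE k : 0 < k -> (\int[lebesgue_rV n]_(x in S) (k `^ (- alpha) * rho (k *: x))%:E =
    (k `^ (- (n%:R + alpha)) *
      fine (P0 (C @^-1` ((fun x => k^-1 *: x) @^-1` S))))%:E)%E.
  move=> k0; rewrite EFinM fineK ?density_scaled//.
  apply: fin_num_measure; rewrite -[X in measurable X]setTI.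
  by apply: measurable_funPT => //; exact: measurable_preimage_scale.
have mhS : measurable_fun S (EFin \o h).
  by apply/measurable_EFinP; apply: measurable_funS h_meas => //; exact: measurable_Rplus.
have mrS k : 0 < k -> measurable_fun S (EFin \o (fun x => k `^ (- alpha) * rho (k *: x))).
  move=> k0; apply/measurable_EFinP; apply: measurable_funM => //.
  apply: (@measurable_comp _ _ _ _ _ _ (Rplus n)) => //.
  + exact: measurable_Rplus.
  + by move=> x [y Sy <-]; rewrite Rplus_scale//; exact: SR.
  + by apply: measurable_funTS; exact: measurable_scale_rV.
have r0S k x : 0 < k -> S x -> 0 <= k `^ (- alpha) * rho (k *: x).
  by move=> k0 Sx; rewrite mulr_ge0 ?powR_ge0// rho0// Rplus_scale//; exact: SR.
have h0S x : S x -> 0 <= h x by move=> /SR/h_ge0.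
have bnd (f g : 'rV[R]_n -> R) (e : R) : 0 <= e ->
    measurable_fun S (EFin \o f) -> measurable_fun S (EFin \o g) ->
    (forall x, S x -> 0 <= f x) -> (forall x, S x -> 0 <= g x) ->
    (forall x, S x -> f x <= g x + e) ->
    (\int[lebesgue_rV n]_(x in S) (f x)%:E <=
     \int[lebesgue_rV n]_(x in S) (g x)%:E + (e * V)%:E)%E.
  move=> e0 mf mg f0 g0 fg.
  rewrite EFinM VE -(@integral_cst _ _ _ (lebesgue_rV n) _ mS) -ge0_integralD//=.
  apply: ge0_le_integral => //.
  apply: emeasurable_funD => //.
have mass e : 0 < e -> exists2 d : R, 0 < d & forall k, 0 < k < d ->
  (\int[lebesgue_rV n]_(x in S) (k `^ (- alpha) * rho (k *: x))%:E <=
   \int[lebesgue_rV n]_(x in S) (h x)%:E + e%:E)%E /\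
  (\int[lebesgue_rV n]_(x in S) (h x)%:E <=
   \int[lebesgue_rV n]_(x in S) (k `^ (- alpha) * rho (k *: x))%:E + e%:E)%E.
  move=> e0; have V1 : 0 < V + 1 by rewrite ltr_pwDr.
  have e'0 : 0 < e / (V + 1) by rewrite divr_gt0.
  have eV : ((e / (V + 1) * V)%:E <= e%:E)%E.
    by rewrite lee_fin mulrAC ler_pdivrMr// ler_pM2l// lerDl.
  have [d dp H] := unif_annulus c0 M0 e'0.
  exists d => // k /[dup] kd /andP[k0 _]; split.
  - apply: le_trans (leeD2l _ eV); apply: bnd => //.
    + exact: ltW.
    + exact: mrS.
    + by move=> x Sx; exact: r0S.
    + move=> x Sx; have := H k x kd (SR _ Sx) (ScM _ Sx).
      by rewrite ler_norml => /andP[_]; rewrite lerBlDl.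
  - apply: le_trans (leeD2l _ eV); apply: bnd => //.
    + exact: ltW.
    + exact: mrS.
    + by move=> x Sx; exact: r0S.
    + move=> x Sx; have := H k x kd (SR _ Sx) (ScM _ Sx).
      by rewrite distrC ler_norml => /andP[_]; rewrite lerBlDl.
(* h is within a constant of an integrand whose integral is a finite multiple
   of a probability *)
have [d1 d1p H1] := mass 1 ltr01.
have int_fin : (\int[lebesgue_rV n]_(x in S) (h x)%:E)%E \is a fin_num.
  rewrite ge0_fin_numE ?integral_ge0//.
  have k0 : 0 < d1 / 2 < d1 by rewrite divr_gt0// ltr_pdivrMr// ltr_pMr// ltr1n.
  have [_] := H1 _ k0; rewrite PfE; last by have /andP[] := k0.
  by move=> /le_lt_trans; apply; rewrite -EFinD ltry.
exists (fine (\int[lebesgue_rV n]_(x in S) (h x)%:E)%E); first by rewrite fineK.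
move=> e e0; have [d dp H] := mass e e0; exists d => // k kd.
have [] := H k kd; rewrite PfE; last by have /andP[] := kd.
rewrite -[in X in X -> _](fineK int_fin) -[in X in _ -> X -> _](fineK int_fin).
rewrite -!EFinD !lee_fin => Ha Hb; rewrite ler_norml lerBlDl Ha andbT.
by rewrite lerBrDl lerBlDr.
Qed.

End homogeneous.

Lemma cvg_right_scale (f : R -> R) (c l : R) : 0 < c ->
  f k @[k --> 0^'+] --> l -> f (k * c) @[k --> 0^'+] --> l.
Proof.
move=> c0 /cvgrPdist_le H; apply/cvgrPdist_le => e /H /at_right0P[d d0 {}H].
apply/at_right0P; exists (d / c); first by rewrite divr_gt0.
by move=> k /andP[k0 kd]; apply: H; rewrite mulr_gt0//= -ltr_pdivlMr.
Qed.

Lemma cvg_right_seq (f : R -> R) (u : nat -> R) (l : R) :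
  (forall j, 0 < u j) -> u j @[j --> \oo] --> 0 ->
  f t @[t --> 0^'+] --> l -> f (u j) @[j --> \oo] --> l.
Proof.
move=> u0 /cvgrPdist_lt uc /cvgrPdist_lt H; apply/cvgrPdist_lt => e /H.
move=> /at_right0P[d d0 {}H]; near=> j; apply: H; rewrite u0/=.
suff : `|0 - u j| < d by rewrite sub0r normrN gtr0_norm.
by near: j; exact: uc.
Unshelve. all: by end_near. Qed.

(** Iterating the first hypothesis bounds f k by f (k / 2^j), which is
    eventually as small as desired.  It replaces the summation of a geometric
    series over dyadic shells. *)
Lemma le0_of_halving (f : R -> R) (d : R) :
  (forall k, 0 < k < d -> f k <= f (k / 2)) ->
  (forall e, 0 < e -> exists2 d', 0 < d' & forall k, 0 < k < d' -> f k <= e) ->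
  forall k, 0 < k < d -> f k <= 0.
Proof.
move=> fhalf f0 k /andP[k0 kd]; apply/ler_addgt0Pl => e e0; rewrite addr0.
have [d' d'0 Hd'] := f0 e e0.
have H j : f k <= f (k / 2 ^+ j) /\ 0 < k / 2 ^+ j < d.
  elim: j => [|j [IH /andP[k0' kd']]]; first by rewrite expr0 divr1 lexx k0.
  have E : k / 2 ^+ j.+1 = k / 2 ^+ j / 2 by rewrite exprSr invfM mulrA.
  split; first by rewrite E (le_trans IH)// fhalf// k0'.
  by rewrite E divr_gt0//= (lt_trans _ kd')// ltr_pdivrMr// ltr_pMr// ltr1n.
have := near_infty_natSinv_expn_lt (PosNum (divr_gt0 d'0 k0)).
move=> [j _ Hj]; have {Hj}/= Hj := Hj j (leqnn j).
have [fk /andP[kj0 _]] := H j; apply: le_trans fk _; apply: Hd'.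
by rewrite kj0/= mulrC -ltr_pdivlMr// -div1r.
Qed.

Lemma pos_lower_bound (T : eqType) (s : seq T) (f : T -> R) :
  exists2 c, 0 < c & forall x, x \in s -> 0 < f x -> c <= f x.
Proof.
elim: s => [|x s [c c0 H]]; first by exists 1.
exists (if 0 < f x then Num.min c (f x) else c).
  by case: ifPn => // fx; rewrite lt_min c0.
move=> y; rewrite inE => /orP[/eqP -> -> | /H{}H /H cy].
  by rewrite ge_min lexx orbT.
by case: ifPn => // _; rewrite ge_min cy.
Qed.

Lemma pos_upper_bound (T : eqType) (s : seq T) (f : T -> R) :
  exists2 c, 0 < c & forall x, x \in s -> f x <= c.
Proof.
elim: s => [|x s [c c0 H]]; first by exists 1.
exists (Num.max c (f x)); first by rewrite lt_max c0.
move=> y; rewrite inE => /orP[/eqP ->|/H cy]; by rewrite le_max ?lexx ?cy ?orbT.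
Qed.

Section cut.
Variables (n : nat) (n_ge2 : (2 <= n)%N).
Variables (q : nat -> 'rV[R]_n) (a : nat -> R) (m : nat).
Hypothesis q_simplex : forall k, simplex n (q k).
Hypothesis a_ge0 : forall k, 0 <= a k.

(** The dilate by t of the union of the sets R(q k, a k) over k < m. *)
Definition cut (t : R) : set 'rV[R]_n :=
  [set x | Rplus n x /\ exists2 k, (k < m)%N & dotp (q k) x < t * a k].

Lemma measurable_cut t : measurable (cut t).
Proof.
rewrite (_ : cut t = Rplus n `&` \bigcup_(k in `I_m) [set x | dotp (q k) x < t * a k]).
  apply: measurableI; first exact: measurable_Rplus.
  apply: bigcup_measurable => k _.
  rewrite -[X in measurable X]setTI (_ : [set x | _] =
    (fun x => dotp (q k) x) @^-1` [set` `]-oo, t * a k[]).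
    by apply: measurable_dotp.
  by apply/seteqP; split=> x /=; rewrite in_itv.
apply/seteqP; split=> x /=.
  by move=> [x0 [k km H]]; split=> //; exists k.
by move=> [x0 [k km H]]; split=> //; exists k.
Qed.

Lemma cut_Rplus t : cut t `<=` Rplus n. Proof. by move=> x []. Qed.

Lemma cut_scale (c t : R) x : 0 < c -> cut (c * t) (c *: x) <-> cut t x.
Proof.
move=> c0; split=> -[x0 [k km H]]; split.
- by rewrite -(Rplus_scale _ c0).
- by exists k => //; move: H; rewrite dotp_scale -mulrA ltr_pM2l.
- by rewrite Rplus_scale.
- by exists k => //; rewrite dotp_scale -mulrA ltr_pM2l.
Qed.

Lemma cut_mono u v : u <= v -> cut u `<=` cut v.
Proof.
move=> uv x [x0 [k km H]]; split=> //; exists k => //.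
by apply: lt_le_trans H _; rewrite ler_wpM2r.
Qed.

(** The q k lie in the open simplex, so each half-space cuts off a bounded part
    of the orthant. *)
Lemma cut_upper : exists2 M, 0 < M & forall t x, 0 < t -> cut t x -> l1 x <= M * t.
Proof.
have [A A0 HA] := pos_upper_bound (iota 0 m) a.
have [e e0 He] := pos_lower_bound [seq (k, i) | k <- iota 0 m, i <- enum 'I_n]
  (fun ki => q ki.1 0 ki.2).
exists (A / e); first by rewrite divr_gt0.
move=> t x t0 [x0 [k km H]].
rewrite mulrAC ler_pdivlMr// mulrC.
apply: (@le_trans _ _ (dotp (q k) x)).
  rewrite /l1 mulr_sumr; apply: ler_sum => i _; rewrite ler_pM2r//.
  have /andP[qi _] := (q_simplex k).1 i.
  apply: (He (k, i)) => //.
  by apply/allpairsP; exists (k, i); rewrite mem_iota add0n km mem_enum.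
apply: le_trans (ltW H) _; rewrite mulrC ler_pM2r//.
by apply: HA; rewrite mem_iota add0n.
Qed.

(** A point outside [cut t] satisfies <q k, x> >= t a_k for all k, hence
    l1 x >= t a_k.  That x lies in [cut v] ensures that some a_k is positive: if
    all a_k vanish, every [cut] is empty. *)
Lemma cut_lower : exists2 c, 0 < c & forall t v x, 0 < t -> 0 < v ->
  cut v x -> ~ cut t x -> c * t <= l1 x.
Proof.
have [c c0 Hc] := pos_lower_bound (iota 0 m) a.
exists c => // t v x t0 v0 [x0 [k km H]] nt.
have ak0 : 0 < a k.
  rewrite -(pmulr_rgt0 _ v0); apply: le_lt_trans H.
  apply: sumr_ge0 => i _; have /andP[qi _] := (q_simplex k).1 i.
  by rewrite mulr_ge0 ?ltW.
apply: (@le_trans _ _ (t * a k)).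
  by rewrite mulrC ler_pM2l//; apply: Hc => //; rewrite mem_iota add0n.
rewrite leNgt; apply/negP => H'; apply: nt; split=> //; exists k => //.
by apply: le_lt_trans H'; exact: dotp_le_l1.
Qed.

Section probability.
Variables (d0 : measure_display) (Omega0 : measurableType d0).
Variables (P0 : probability Omega0 R) (C : {RV P0 >-> 'rV[R]_n}).
Variables (alpha : R) (h rho : 'rV[R]_n -> R).
Hypothesis C_density : has_density C rho.
Hypothesis h_meas : measurable_fun (Rplus n) h.
Hypothesis h_ge0 : forall x, Rplus n x -> 0 <= h x.
Hypothesis h_cvg : forall x, Rplus n x ->
  kappa `^ (- alpha) * rho (kappa *: x) @[kappa --> 0^'+] --> h x.
Hypothesis h_unif : {uniform simplex n,
  (fun kappa x => kappa `^ (- alpha) * rho (kappa *: x)) @ 0^'+ --> h}.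

Local Notation beta := (n%:R + alpha).

Definition cut_prob (t : R) : R := fine (P0 (C @^-1` cut t)).

Lemma measurable_preC A : measurable A -> measurable (C @^-1` A).
Proof.
by move=> mA; rewrite -[X in measurable X]setTI; apply: measurable_funPT.
Qed.

Lemma cut_probE t : P0 (C @^-1` cut t) = (cut_prob t)%:E.
Proof.
by rewrite fineK// fin_num_measure//; apply: measurable_preC; exact: measurable_cut.
Qed.

Lemma cut_prob_ge0 t : 0 <= cut_prob t. Proof. by rewrite fine_ge0. Qed.

Lemma cut_prob_le1 t : cut_prob t <= 1.
Proof.
rewrite -lee_fin -cut_probE; apply: probability_le1; apply: measurable_preC.
exact: measurable_cut.
Qed.

Lemma cut_prob_mono u v : u <= v -> cut_prob u <= cut_prob v.
Proof.
move=> uv; rewrite -lee_fin -!cut_probE; apply: le_measure; rewrite ?inE.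
- by apply: measurable_preC; exact: measurable_cut.
- by apply: measurable_preC; exact: measurable_cut.
- by move=> w; exact: (cut_mono uv).
Qed.

Lemma cut_diff_prob u v : u <= v ->
  fine (P0 (C @^-1` (cut v `\` cut u))) = cut_prob v - cut_prob u.
Proof.
move=> uv; rewrite (_ : _ @^-1` _ = C @^-1` cut v `\` C @^-1` cut u)//.
rewrite measureD; last 3 first.
- by apply: measurable_preC; exact: measurable_cut.
- by apply: measurable_preC; exact: measurable_cut.
- rewrite (le_lt_trans (probability_le1 _ _)) ?ltry//.
  by apply: measurable_preC; exact: measurable_cut.
rewrite (_ : _ `&` _ = C @^-1` cut u).
  by rewrite fineB// fin_num_measure//; apply: measurable_preC; exact: measurable_cut.
apply/seteqP; split=> w /=; first by case.
by move=> H; split=> //; apply: (cut_mono uv).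
Qed.

Lemma cut_small x : Rplus n x -> exists2 d : R, 0 < d & forall t, 0 < t < d -> ~ cut t x.
Proof.
move=> x0; have [M M0 HM] := cut_upper; have r0 := l1_gt0 n_ge2 x0.
exists (l1 x / M); first by rewrite divr_gt0.
move=> t /andP[t0 tM] /(HM _ _ t0); apply/negP; rewrite -ltNge.
by rewrite mulrC -ltr_pdivlMr.
Qed.

(** Continuity of P0 from above: every point of the orthant leaves [cut t] for
    small t. *)
Lemma cut_prob_cvg0 : cut_prob t @[t --> 0^'+] --> 0.
Proof.
pose F j := C @^-1` cut j.+1%:R^-1.
have F0 : \bigcap_j F j = set0.
  apply/seteqP; split=> // w Fw; have x0 := (Fw 0%N I).1.
  have [d dp Hd] := cut_small x0.
  apply: (Hd (Num.trunc d^-1).+1%:R^-1); last exact: Fw.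
  by rewrite invr_gt0 ltr0n/= invf_plt ?posrE ?ltr0n// truncnS_gt.
have mF j : measurable (F j) by apply: measurable_preC; exact: measurable_cut.
have : (P0 \o F) j @[j --> \oo] --> P0 (\bigcap_j F j).
  apply: nonincreasing_cvg_mu => //.
  - by rewrite (le_lt_trans (probability_le1 _ _)) ?ltry.
  - by rewrite F0.
  - move=> i j ij; apply/subsetPset => w; apply: cut_mono.
    by rewrite lef_pV2 ?posrE ?ltr0n// ler_nat ltnS.
rewrite F0 measure0 => /fine_cvgP[_]/cvgrPdist_lt H.
apply/cvgrPdist_lt => e /H [j _ {}H]; apply/at_right0P.
exists j.+1%:R^-1; first by rewrite invr_gt0 ltr0n.
move=> t /andP[t0 tj]; apply: le_lt_trans (H j (leqnn j)).
rewrite !sub0r !normrN !ger0_norm ?cut_prob_ge0 ?fine_ge0//.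
by apply: cut_prob_mono; exact: ltW.
Qed.

Lemma cut_diff_cvg u v : 0 < u -> u <= v -> exists2 H : R,
  (\int[lebesgue_rV n]_(x in cut v `\` cut u) (h x)%:E = H%:E)%E &
  k `^ (- beta) * (cut_prob (k * v) - cut_prob (k * u)) @[k --> 0^'+] --> H.
Proof.
move=> u0 uv; have v0 := lt_le_trans u0 uv.
have [M M0 HM] := cut_upper; have [c c0 Hc] := cut_lower.
have [||||x [cvx ncux]|H HE Hcvg] := @annulus_cvg n n_ge2 _ _ P0 C alpha h rho
  C_density h_meas h_ge0 h_cvg h_unif (cut v `\` cut u) (c * u) (M * v).
- by rewrite mulr_gt0.
- by rewrite mulr_gt0.
- by apply: measurableD; exact: measurable_cut.
- by move=> x [/cut_Rplus].
- by rewrite (Hc _ v)// HM.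
exists H => //; apply/cvgrPdist_le => e /Hcvg[d dp {}Hd].
apply/at_right0P; exists d => // k /[dup] kd /andP[k0 _].
rewrite distrC -cut_diff_prob; last by rewrite ler_pM2l.
rewrite (_ : cut _ `\` _ = (fun x => k^-1 *: x) @^-1` (cut v `\` cut u)).
  exact: Hd.
have E t x : cut (k * t) x <-> cut t (k^-1 *: x).
  by have := cut_scale t (k^-1 *: x) k0; rewrite scalerA mulfV ?gt_eqF// scale1r.
by apply/seteqP; split=> x [/= /E ? nx]; split=> // /E.
Qed.

(** Monotone convergence; the inner radius 1 / (j + 1) shrinks to 0 and in the
    limit nothing is removed, by [cut_small]. *)
Lemma shell_cvg (v : nat -> R) : nondecreasing_seq v ->
  (\int[lebesgue_rV n]_(x in cut (v j) `\` cut (harmonic j)) (h x)%:E)%E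
    @[j --> \oo] -->
  (\int[lebesgue_rV n]_(x in \bigcup_j cut (v j)) (h x)%:E)%E.
Proof.
move=> ndv.
have hm : {homo (@harmonic R) : i j / (i <= j)%N >-> j <= i}.
  by move=> i j ij; rewrite /harmonic lef_pV2 ?posrE ?ltr0n// ler_nat ltnS.
have mS j : measurable (cut (v j) `\` cut (harmonic j)).
  by apply: measurableD; exact: measurable_cut.
rewrite (_ : \bigcup_j _ = \bigcup_j (cut (v j) `\` cut (harmonic j))).
  apply: ge0_nondecreasing_set_cvg_integral => //.
  - move=> i j ij; apply/subsetPset => x [cx nx]; split.
      by apply: cut_mono cx; exact: ndv.
    by move=> /cut_mono H; apply: nx; apply: H; exact: hm.
  - move=> i; apply/measurable_EFinP; apply: measurable_funS h_meas => //.
      exact: measurable_Rplus.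
    by move=> x [/cut_Rplus].
  - by move=> i x [/cut_Rplus/h_ge0]; rewrite lee_fin.
apply/seteqP; split=> x [j _]; last by case=> ? _; exists j.
move=> cx; have [d dp Hd] := cut_small (cut_Rplus cx).
exists (maxn j (Num.trunc d^-1)) => //; split.
  by apply: cut_mono cx; apply: ndv; exact: leq_maxl.
move=> /(cut_mono (hm _ _ (leq_maxr _ _))); apply: Hd.
by rewrite harmonic_gt0/= /harmonic invf_plt ?posrE ?ltr0n// truncnS_gt.
Qed.

(** Write phi for [cut_prob], H for the h-mass of the shell between 1/2 and 1,
    and W = 2^(-beta).  Since phi k - phi (k / 2) is within e (1 - W) k^beta of
    H k^beta, and k^beta - (k / 2)^beta = (1 - W) k^beta, the functions
    phi k - (L + e) k^beta and (L - e) k^beta - phi k with L = H / (1 - W) do not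
    decrease when k is halved; both tend to values <= 0 at 0, so both are <= 0
    by [le0_of_halving].  That L is the h-mass of [cut 1] follows by comparing
    with the shells between 1 / (j + 1) and 1, of h-mass L - (j + 1)^(-beta) L. *)
Lemma cut_prob_cvg : 0 < beta -> exists2 L : R,
  (\int[lebesgue_rV n]_(x in cut 1) (h x)%:E = L%:E)%E &
  k `^ (- beta) * cut_prob k @[k --> 0^'+] --> L.
Proof.
move=> b0.
have half0 : 0 < 2^-1 :> R by rewrite invr_gt0.
have [||H HE Hcvg] := @cut_diff_cvg 2^-1 1 => //.
  by rewrite invf_le1// ler1n.
set W := 2^-1 `^ beta.
have W1 : 0 < 1 - W.
  have E1 : 1 = 1 `^ beta :> R by rewrite powR1.
  by rewrite subr_gt0 [ltRHS]E1 gt0_ltr_powR// ?nnegrE// invf_lt1// ltr1n.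
have H0 : 0 <= H.
  rewrite -lee_fin -HE integral_ge0// => x [/cut_Rplus/h_ge0 + _].
  by rewrite lee_fin.
have kb k : 0 < k -> (k / 2) `^ beta = k `^ beta * W by move=> k0; rewrite powRM ?ltW.
have kbi k : 0 < k -> k `^ beta * k `^ (- beta) = 1.
  move=> k0; rewrite -powRD ?subrr ?powRr0//.
  by apply/implyP => _; rewrite gt_eqF.
pose L := H / (1 - W).
have Lcvg : k `^ (- beta) * cut_prob k @[k --> 0^'+] --> L.
  apply/cvgrPdist_le => e e0; have e'0 : 0 < e * (1 - W) by rewrite mulr_gt0.
  move/cvgrPdist_le : Hcvg => /(_ _ e'0)/at_right0P[d dp Hd].
  have step k : 0 < k < d ->
     (H - e * (1 - W)) * k `^ beta <= cut_prob k - cut_prob (k / 2) <=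
     (H + e * (1 - W)) * k `^ beta.
    move=> /[dup] /andP[k0 _] /Hd; rewrite mulr1 ler_distlC.
    set D := cut_prob k - _ => HD; have -> : D = k `^ beta * (k `^ (- beta) * D).
      by rewrite mulrA kbi// mul1r.
    by rewrite ![_ * k `^ beta]mulrC !ler_pM2l// powR_gt0.
  have up k : 0 < k < d -> cut_prob k - (L + e) * k `^ beta <= 0.
    apply: (le0_of_halving (f := fun k => cut_prob k - (L + e) * k `^ beta)).
      move=> {}k /[dup] /andP[k0 _] /step/andP[_].
      rewrite (kb _ k0) -(@ler_pM2r _ (1 - W))//.
      have -> : H = L * (1 - W) by rewrite /L divfK// gt_eqF.
      move=> sk; rewrite -(@ler_pM2r _ (1 - W))//.
      by move: sk; rewrite !ler_pM2r//; lra.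
    move=> e1 e10; move/cvgrPdist_le : cut_prob_cvg0 => /(_ _ e10)/at_right0P[d' d'0 Hd'].
    exists d' => // {}k /Hd'; rewrite sub0r normrN ger0_norm ?cut_prob_ge0//.
    move=> pe; apply: le_trans pe; rewrite gerDl oppr_le0 mulr_ge0 ?powR_ge0//.
    by apply: addr_ge0; [rewrite /L; apply: divr_ge0 => //; exact: ltW|exact: ltW].
  have lo k : 0 < k < d -> (L - e) * k `^ beta - cut_prob k <= 0.
    apply: (le0_of_halving (f := fun k => (L - e) * k `^ beta - cut_prob k)).
      move=> {}k /[dup] /andP[k0 _] /step/andP[+ _].
      rewrite (kb _ k0).
      have -> : H = L * (1 - W) by rewrite /L divfK// gt_eqF.
      by lra.
    move=> e1 e10.
    have : (L - e) * k `^ beta @[k --> 0^'+] --> (L - e) * 0.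
      by apply: cvgMr; exact: powR_cvg0.
    rewrite mulr0 => /cvgrPdist_le/(_ _ e10)/at_right0P[d' d'0 Hd'].
    exists d' => // {}k /Hd'; rewrite sub0r normrN => /ler_normlW.
    by move=> pe; apply: le_trans pe; rewrite gerDl oppr_le0 cut_prob_ge0.
  apply/at_right0P; exists d => // k /[dup] kd /andP[k0 _].
  have pk := powR_gt0 beta k0.
  have E : k `^ beta * (k `^ (- beta) * cut_prob k) = cut_prob k.
    by rewrite mulrA kbi// mul1r.
  rewrite ler_distlC -(ler_pM2l pk) -(ler_pM2l pk (_ * cut_prob k)) E.
  by have := up _ kd; have := lo _ kd; rewrite !subr_le0 ![_ * _ `^ _]mulrC => -> ->.
exists L => //.
have Hj j : (\int[lebesgue_rV n]_(x in cut 1 `\` cut (harmonic j)) (h x)%:E =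
    (L - harmonic j `^ beta * L)%:E)%E.
  have h0 : 0 < harmonic j :> R := harmonic_gt0 j.
  have [||K -> Kcvg] := @cut_diff_cvg (harmonic j) 1 => //.
    by rewrite /harmonic invf_le1 ?ltr0n// ler1n.
  congr (_%:E); apply/esym; apply: (cvg_unique _ _ Kcvg) => //.
  apply: (@cvg_trans _ (k `^ (- beta) * cut_prob k - harmonic j `^ beta *
      ((k * harmonic j) `^ (- beta) * cut_prob (k * harmonic j))
      @[k --> 0^'+])); last first.
    apply: cvgB => //; apply: cvgMr.
    exact: (@cvg_right_scale (fun k => k `^ (- beta) * cut_prob k)).
  apply: near_eq_cvg; apply/at_right0P; exists 1 => // k /andP[k0 _].
  rewrite mulr1 powRM ?ltW// mulrBr; congr (_ - _).
  set y := cut_prob _; rewrite (_ : _ * _ =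
    (harmonic j `^ beta * harmonic j `^ (- beta)) * (k `^ (- beta) * y)); last by ring.
  by rewrite kbi// mul1r.
have nd1 : nondecreasing_seq (fun _ : nat => 1 : R) by move=> i j _; exact: (lexx (1 : R)).
have := shell_cvg nd1.
rewrite bigcup_const//.
under eq_fun do rewrite Hj.
move=> Lim; apply: (cvg_unique _ Lim) => //.
apply: cvg_EFin; first exact: nearW.
rewrite /comp/= -[X in _ --> X]subr0 -[X in _ - X](mul0r L).
apply: cvgB; first exact: cvg_cst.
apply: cvgMl; apply: (@cvg_right_seq (fun t => t `^ beta) harmonic).
- exact: harmonic_gt0.
- exact: cvg_harmonic.
- exact: powR_cvg0.
Qed.

Hypothesis h_pos : (0 < \int[lebesgue_rV n]_(x in Rplus n) (h x)%:E)%E.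

(** If beta <= 0, then k^(-beta) <= 1 for small k, and since [cut_prob] tends to
    0 at 0 every shell has h-mass 0.  When some a_k is positive the shells
    exhaust the orthant, contradicting [h_pos]. *)
Lemma exponent_gt0 : (exists2 k, (k < m)%N & 0 < a k) -> 0 < beta.
Proof.
move=> [k0 k0m ak0]; rewrite ltNge; apply/negP => b0.
have shell0 j : (\int[lebesgue_rV n]_(x in cut j.+1%:R `\` cut (harmonic j))
    (h x)%:E = 0)%E.
  have [||K -> Kcvg] := @cut_diff_cvg (harmonic j) j.+1%:R; first exact: harmonic_gt0.
    by rewrite /harmonic (@le_trans _ _ 1)// ?invf_le1 ?ltr0n// ler1n.
  congr (_%:E); apply: (cvg_unique _ Kcvg) => //.
  have Hc : cut_prob (k * j.+1%:R) @[k --> 0^'+] --> 0.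
    by apply: cvg_right_scale; [rewrite ltr0n|exact: cut_prob_cvg0].
  apply/cvgrPdist_le => e e0.
  move/cvgrPdist_le : Hc => /(_ _ e0)/at_right0P[d dp Hd].
  apply/at_right0P; exists (Num.min d 1); first by rewrite lt_min dp ltr01.
  move=> k /andP[kp]; rewrite lt_min => /andP[kd k1].
  have := Hd k; rewrite kp kd => /(_ isT).
  rewrite !sub0r !normrN ger0_norm ?cut_prob_ge0// => /(le_trans _); apply.
  have D0 : 0 <= cut_prob (k * j.+1%:R) - cut_prob (k * harmonic j).
    rewrite subr_ge0; apply: cut_prob_mono; rewrite ler_pM2l//.
    by rewrite /harmonic (@le_trans _ _ 1)// ?invf_le1 ?ltr0n// ler1n.
  rewrite ger0_norm ?mulr_ge0 ?powR_ge0//.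
  apply: (@le_trans _ _ (1 * (cut_prob (k * j.+1%:R) - cut_prob (k * harmonic j)))).
    have E1 : 1 = 1 `^ (- beta) :> R by rewrite powR1.
    apply: ler_wpM2r => //; rewrite [leRHS]E1.
    by apply: ge0_ler_powR; rewrite ?oppr_ge0// ?nnegrE ltW.
  by rewrite mul1r gerDl oppr_le0 cut_prob_ge0.
have ndS : nondecreasing_seq (fun j => j.+1%:R : R).
  by move=> i j ij; rewrite ler_nat ltnS.
have := shell_cvg ndS; under eq_fun do rewrite shell0.
rewrite (_ : \bigcup_j _ = Rplus n).
  move=> H; have E : (\int[lebesgue_rV n]_(x in Rplus n) (h x)%:E = 0)%E.
    by apply: (cvg_unique _ H (cvg_cst _)).
  by move: h_pos; rewrite E ltxx.
apply/seteqP; split=> x; first by move=> [j _ /cut_Rplus].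
move=> x0; exists (Num.trunc (dotp (q k0) x / a k0)) => //; split=> //.
by exists k0 => //; rewrite -ltr_pdivrMr// truncnS_gt.
Qed.

End probability.
End cut.
End regular_variation.

(** * Concave functions on the simplex and their Borel sets *)

Section concave_topology.
Context {R : realType}.
Variables (n : nat) (n_ge2 : (2 <= n)%N).

(** Mixing with the barycenter moves a point with non-negative coordinates into
    the open simplex. *)
Lemma closed_simplexP (y : 'rV[R]_n) :
  closed_simplex n y <-> (forall i, 0 <= y 0 i) /\ \sum_i y 0 i = 1.
Proof.
split=> [cy|[y0 y1]].
  split; first by move=> i; exact: closed_simplex_ge0.
  pose f (q : 'rV[R]_n) : R := dotp q (const_mx 1).
  have fE q : f q = \sum_i q 0 i by apply: eq_bigr => i _; rewrite mxE mulr1.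
  rewrite -fE; have cl : closed (f @^-1` [set x | x = 1]).
    apply: closed_comp => [x _|]; first exact: dotp_continuous.
    exact: closed_eq.
  by apply: cl; apply: closure_subset cy => q [_ q1] /=; rewrite fE.
have n0 : (0 < n)%N := ltnW n_ge2.
pose c : 'rV[R]_n := const_mx n%:R^-1.
have sc s : 0 < s <= 1 -> simplex n ((1 - s) *: y + s *: c).
  move=> /andP[s0 s1].
  have y_le1 i : y 0 i <= 1.
    by rewrite -y1 (bigD1 i)//= lerDl sumr_ge0.
  have n1 : n%:R^-1 < 1 :> R by rewrite invf_lt1 ?ltr0n// ltr1n.
  have ni : 0 < n%:R^-1 :> R by rewrite invr_gt0 ltr0n.
  split=> [i|].
    rewrite !mxE; have := y0 i; have := y_le1 i => yi1 yi0.
    by apply/andP; split; nra.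
  under eq_bigr do rewrite !mxE.
  rewrite big_split/= -!mulr_sumr y1 sumr_const card_ord -[_ *+ n]mulr_natr.
  by rewrite mulVf ?pnatr_eq0 -?lt0n//; ring.
move=> B By.
have : (1 - s) *: y + s *: c @[s --> (0 : R)] --> (1 - 0) *: y + 0 *: c.
  apply: cvgD; apply: cvgZr_tmp; last exact: cvg_id.
  by apply: cvgB; [exact: cvg_cst|exact: cvg_id].
rewrite subr0 scale1r scale0r addr0 => /(_ B By)[e /= e0 He].
pose s := Num.min (e / 2) 1.
have s0 : 0 < s by rewrite lt_min divr_gt0//=.
exists ((1 - s) *: y + s *: c); split.
  by apply: sc; rewrite s0/= ge_min lexx orbT.
apply: He => /=; rewrite sub0r normrN gtr0_norm//.
by rewrite gt_min ltr_pdivrMr// ltr_pMr// ltr1n.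
Qed.

Definition simplex_point (y : 'rV[R]_n) (H : closed_simplex n y) : closed_simplex n :=
  exist _ y (mem_set H).

Lemma simplex_sub (y : 'rV[R]_n) : simplex n y -> closed_simplex n y.
Proof. exact: subset_closure. Qed.

Lemma closed_simplex_dense (p : @closed_simplex R n) (U : set (@closed_simplex R n)) :
  open U -> U p -> exists2 r, U r & simplex n (\val r).
Proof.
move=> [V oV <-] Vp.
have cp : closure (simplex n) (\val p) by exact: set_mem (valP p).
have [r [sr Vr]] := cp V (open_nbhs_nbhs (conj oV Vp)).
by exists (simplex_point (simplex_sub sr)).
Qed.

(** The point z is a convex combination of x, with weight 1 - t, and of another
    point of the closed simplex; concavity bounds g z below and the second term
    is dropped because g >= 0. *)
Lemma concave_lower (g : conc_fun R n) (t : R) (x z : closed_simplex n) :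
  0 < t <= 1 -> (forall i, (1 - t) * \val x 0 i <= \val z 0 i) ->
  (1 - t) * g x <= g z.
Proof.
move=> /andP[t0 t1] xz.
have /closed_simplexP[x0 x1] := set_mem (valP x).
have /closed_simplexP[z0 z1] := set_mem (valP z).
pose y : 'rV[R]_n := t^-1 *: (\val z - (1 - t) *: \val x).
have cy : closed_simplex n y.
  apply/closed_simplexP; split.
    move=> i; rewrite !mxE mulr_ge0 ?invr_ge0 ?(ltW t0)//.
    by rewrite subr_ge0.
  under eq_bigr do rewrite !mxE.
  rewrite -mulr_sumr sumrB -mulr_sumr x1 z1 mulr1 opprB addrCA subrr addr0.
  by rewrite mulVf// gt_eqF.
have t01 : 0 <= 1 - t <= 1 by rewrite subr_ge0 t1/= gerBl ltW.
have zE : \val z = (1 - t) *: \val x + (1 - (1 - t)) *: \val (simplex_point cy).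
  by rewrite /= /y subKr scalerA mulfV ?gt_eqF// scale1r addrC subrK.
apply: le_trans (@conc_fun_concave R n g _ _ _ _ t01 zE).
by rewrite lerDl mulr_ge0 ?conc_fun_ge0// subKr ltW.
Qed.

(** The barycenter c satisfies c >= x / n for every x, so f x <= n f c. *)
Lemma concave_bounded (f : conc_fun R n) : exists2 M : R, 0 < M & forall x, f x <= M.
Proof.
have n0 : (0 < n)%N := ltnW n_ge2.
have cc : closed_simplex n (const_mx n%:R^-1 : 'rV[R]_n).
  apply/closed_simplexP; split=> [i|]; first by rewrite mxE invr_ge0.
  under eq_bigr do rewrite !mxE.
  by rewrite sumr_const card_ord -[_ *+ n]mulr_natr mulVf ?pnatr_eq0 -?lt0n.
exists (n%:R * f (simplex_point cc) + 1).
  by rewrite ltr_pwDr// mulr_ge0// conc_fun_ge0.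
move=> x; have n1 : n%:R^-1 < 1 :> R by rewrite invf_lt1 ?ltr0n// ltr1n.
have := @concave_lower f (1 - n%:R^-1) x (simplex_point cc).
rewrite subr_gt0 n1 gerBl invr_ge0 ler0n subKr => /(_ isT) H.
rewrite -lerBlDr (@le_trans _ _ (f x))// ?gerBl//.
rewrite -ler_pdivrMl ?ltr0n//; apply: H => i; rewrite mxE.
rewrite ler_piMr// ?invr_ge0 ?ler0n//.
have /closed_simplexP[x0 <-] := set_mem (valP x).
by rewrite (bigD1 i)//= lerDl sumr_ge0.
Qed.

(** Shifting the weights by one keeps all coordinates positive, so that every m
    gives a point of the open simplex. *)
Definition grid_point (m : {ffun 'I_n -> nat}) : 'rV[R]_n :=
  \row_i ((m i).+1%:R / \sum_j (m j).+1%:R).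

Lemma grid_point_simplex m : simplex n (grid_point m).
Proof.
have i0 : 'I_n := Ordinal (ltnW n_ge2).
pose v : 'rV[R]_n := \row_i (m i).+1%:R.
have v0 : Rplus n v by move=> i; rewrite mxE ltr0n.
have := simplex_normalize n_ge2 v0; congr (simplex n _).
apply/rowP => i; rewrite !mxE mulrC; congr (_ / _).
by apply: eq_bigr => j _; rewrite mxE.
Qed.

(** Closeness in the Thompson metric max_i |log (p_i / q_i)|, the radius being
    - log (1 - t). *)
Definition thompson_close (t : R) (p q : 'rV[R]_n) :=
  forall i, (1 - t) * p 0 i <= q 0 i /\ (1 - t) * q 0 i <= p 0 i.

(** For N large take m_i = floor (N p_i): then the sum S of the m_i + 1 lies
    between N and N + n, and (m_i + 1) / S is p_i up to a factor 1 - t as soon as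
    n <= t N and 1 <= t N p_i for all i. *)
Lemma grid_point_dense (p : 'rV[R]_n) (t : R) : simplex n p -> 0 < t < 1 ->
  exists m, thompson_close t p (grid_point m).
Proof.
move=> [p01 p1] /andP[t0 t1].
have [c c0 Hc] := @pos_lower_bound R _ (enum 'I_n) (fun i => p 0 i).
have pc i : c <= p 0 i.
  by apply: Hc; rewrite ?mem_enum//; have /andP[] := p01 i.
(* N is real: only the products N p_i are rounded *)
pose N : R := n%:R / t + (t * c)^-1.
have n0 : 0 < n%:R :> R by rewrite ltr0n ltnW.
have N0 : 0 < N by rewrite addr_gt0 ?divr_gt0// invr_gt0 mulr_gt0.
have Nn : n%:R <= t * N.
  rewrite mulrDr mulrCA mulfV ?gt_eqF// mulr1 lerDl mulr_ge0 ?ltW//.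
  by rewrite invr_gt0 mulr_gt0.
have Nc i : 1 <= t * N * p 0 i.
  apply: (@le_trans _ _ (t * N * c)); last by rewrite ler_pM2l// mulr_gt0.
  rewrite mulrAC mulrDr mulfV; last by rewrite gt_eqF// mulr_gt0.
  by rewrite lerDr mulr_ge0 ?divr_ge0 ?mulr_ge0 ?ltW.
pose m : {ffun 'I_n -> nat} := [ffun i => Num.trunc (N * p 0 i)].
have mb i : N * p 0 i < (m i).+1%:R <= N * p 0 i + 1.
  rewrite ffunE truncnS_gt/= -addn1 natrD lerD2r.
  have /andP[pi0 _] := p01 i.
  by have /andP[] := @truncn_itv R (N * p 0 i) (mulr_ge0 (ltW N0) (ltW pi0)).
set S := \sum_j (m j).+1%:R : R.
have SN : N <= S <= N + n%:R.
  apply/andP; split.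
    rewrite -[leLHS]mulr1 -p1 mulr_sumr; apply: ler_sum => i _.
    by have /andP[/ltW] := mb i.
  have -> : N + n%:R = \sum_i (N * p 0 i + 1).
    by rewrite big_split/= -mulr_sumr p1 mulr1 sumr_const card_ord.
  by apply: ler_sum => i _; have /andP[] := mb i.
have /andP[NS SNn] := SN.
have S0 : 0 < S := lt_le_trans N0 NS.
exists m => i; rewrite mxE -/S; have /andP[m1 m2] := mb i.
have /andP[pi0 pi1] := p01 i; have Nci := Nc i.
split.
  rewrite ler_pdivlMr//; apply: le_trans (ltW m1).
  rewrite mulrAC ler_pM2r//.
  by nra.
rewrite mulrA ler_pdivrMr//.
apply: (@le_trans _ _ (p 0 i * N)); last by rewrite ler_pM2l.
by nra.
Qed.

Definition grid_seq (k : nat) : closed_simplex n :=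
  simplex_point (simplex_sub (grid_point_simplex
    (odflt [ffun=> 0%N] (@choice.unpickle {ffun 'I_n -> nat} k)))).

Lemma grid_seq_simplex k : simplex n (\val (grid_seq k)).
Proof. exact: grid_point_simplex. Qed.

Lemma grid_seq_dense (p : 'rV[R]_n) (t : R) : simplex n p -> 0 < t < 1 ->
  exists k, thompson_close t p (\val (grid_seq k)).
Proof.
move=> sp t01; have [m Hm] := grid_point_dense sp t01.
by exists (choice.pickle m); rewrite /grid_seq/= choice.pickleK.
Qed.

Lemma conc_fun_eval_continuous (p : closed_simplex n) : simplex n (\val p) ->
  continuous (fun g : conc_fun R n => g p).
Proof.
move=> sp f.
have /conc_fun_cvgE/fam_cvgP/(_ [set p]) : nbhs f --> f by apply: cvg_id.
have cp : simplex_compacts [set p].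
  by split; [exact: compact_set1|move=> _ ->].
by move=> /(_ cp); rewrite uniform_set1.
Qed.

(** By [concave_lower] values at x and at z agree up to a factor 1 - t for both
    functions, so closeness at z is inherited by x.  Only f is known to be
    bounded by M; this is enough because the bound on g x is obtained by
    contradiction from the one on f x. *)
Lemma thompson_pinch (f g : conc_fun R n) (x z : closed_simplex n) (M t e : R) :
  0 < t -> 4 * t <= 1 -> 0 < e -> f x <= M -> 8 * t * M <= e -> 0 <= M ->
  thompson_close t (\val x) (\val z) -> `|f z - g z| <= e -> `|f x - g x| <= 4 * e.
Proof.
move=> t0 t4 e0 fM tM M0 xz; rewrite !ler_distl => /andP[fg gf].
have t1 : t < 1 by lra.
have t01 : 0 < t <= 1 by rewrite t0 ltW.
have f1 := concave_lower f t01 (fun i => (xz i).1).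
have f2 := concave_lower f t01 (fun i => (xz i).2).
have g1 := concave_lower g t01 (fun i => (xz i).1).
have g2 := concave_lower g t01 (fun i => (xz i).2).
have fx0 := conc_fun_ge0 f x; have gx0 := conc_fun_ge0 g x.
have tfM : t * f x <= t * M by rewrite ler_pM2l.
have te : t * e <= 4^-1 * e by rewrite ler_pM2r//; lra.
have s0 : 0 < 1 - t by lra.
apply/andP; split; last first.
  apply: (@le_trans _ _ ((1 - t) * g z + e + 2 * (t * f x))).
    have : (1 - t) * ((1 - t) * f x) <= (1 - t) * (g z + e).
      by rewrite ler_pM2l// (le_trans f1)//; lra.
    have : 0 <= t * (t * f x) by rewrite !mulr_ge0// ltW.
    by nra.
  by lra.
rewrite leNgt; apply/negP => gx.
have G1 : (1 - t) * ((1 - t) * g x) <= (1 - t) * (f z + e).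
  by rewrite ler_pM2l// (le_trans g1)//; lra.
have G2 : 0 <= t * (t * g x) by rewrite !mulr_ge0// ltW.
have G3 : (1 - 2 * t) * (f x + 4 * e) < (1 - 2 * t) * g x.
  by rewrite ltr_pM2l; lra.
by nra.
Qed.

Definition grid_nbhd (f : conc_fun R n) (m : nat) : set (conc_fun R n) :=
  [set g | forall k, (k < m)%N -> `|f (grid_seq k) - g (grid_seq k)| < m.+1%:R^-1].

Lemma grid_nbhd_anti f m m' : (m <= m')%N -> grid_nbhd f m' `<=` grid_nbhd f m.
Proof.
move=> mm g H k km; apply: lt_le_trans (H k (leq_trans km mm)) _.
by rewrite lef_pV2 ?posrE ?ltr0n// ler_nat ltnS.
Qed.

(** The Thompson balls around grid points cover the compact set K; finitely
    many suffice, and [thompson_pinch] applies on each of them. *)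
Lemma grid_nbhd_unif_compact (f : conc_fun R n) (K : set (closed_simplex n)) (e : R) :
  simplex_compacts K -> 0 < e ->
  exists m, forall g, grid_nbhd f m g -> forall x, K x -> `|f x - g x| < e.
Proof.
move=> [cK Ks] e0; have [M M0 fM] := concave_bounded f.
pose e' := e / 8; have e'0 : 0 < e' by rewrite divr_gt0.
pose t := Num.min 4^-1 (e' / (8 * M)).
have t0 : 0 < t by rewrite lt_min invr_gt0 ltr0n/= divr_gt0// mulr_gt0.
have t4 : 4 * t <= 1.
  by rewrite mulrC -ler_pdivlMr// mul1r ge_min lexx.
have tM : 8 * t * M <= e'.
  by rewrite mulrAC mulrC -ler_pdivlMr ?mulr_gt0// ge_min lexx orbT.
have t1 : t < 1 by lra.
have /compact_near_coveringP/(_ _ \oo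
  (fun m x => exists2 k, (k < m)%N & thompson_close t (\val x) (\val (grid_seq k)))) := cK.
case.
  move=> x Kx; have t2 : 0 < t / 2 < 1 by rewrite divr_gt0//=; lra.
  have [k Hk] := grid_seq_dense (Ks _ Kx) t2.
  have xpos i : 0 < \val x 0 i by have [/(_ i)/andP[]] := Ks _ Kx.
  have qpos i : 0 < \val (grid_seq k) 0 i.
    by have [/(_ i)/andP[]] := grid_seq_simplex k.
  have vc i : (fun y : closed_simplex n => \val y 0 i) @ x --> \val x 0 i.
    have valc : continuous (\val : @closed_simplex R n -> 'rV[R]_n).
      exact: initial_continuous.
    exact: (continuous_comp (valc x) (@coord_continuous R 1 n 0 i (\val x))).
  (* the grid point is chosen at half the radius so that the inequalities at x
     are strict and persist nearby *)
  have nx : \forall y \near x, thompson_close t (\val y) (\val (grid_seq k)).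
    apply: (@filter_forall _ _ (fun i => [set y : closed_simplex n |
      (1 - t) * \val y 0 i <= \val (grid_seq k) 0 i /\
      (1 - t) * \val (grid_seq k) 0 i <= \val y 0 i]) (nbhs x)) => i.
    have [h1 h2] := Hk i.
    have qi := qpos i; have xi := xpos i.
    have A1 : \val x 0 i < \val (grid_seq k) 0 i / (1 - t).
      by rewrite ltr_pdivlMr ?subr_gt0//; nra.
    have A2 : (1 - t) * \val (grid_seq k) 0 i < \val x 0 i by nra.
    near=> y; split.
      rewrite mulrC -ler_pdivlMr ?subr_gt0//; apply: ltW; near: y.
      exact: (cvgr_lt _ (vc i)).
    apply: ltW; near: y; exact: (cvgr_gt _ (vc i)).
  exists ([set y | thompson_close t (\val y) (\val (grid_seq k))], [set j | (k < j)%N]).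
    by split=> //=; exists k.+1.
  by move=> [y j] /= [Hy kj]; exists k.
move=> m1 _ Hm1; pose m := maxn m1 (Num.trunc e'^-1).
exists m => g Hg x Kx.
have [k km1 xk] := Hm1 m1 (leqnn m1) x Kx.
apply: (@le_lt_trans _ _ (4 * e')); last by rewrite /e'; lra.
apply: (@thompson_pinch f g x (grid_seq k) M t) => //; first exact: ltW.
apply: ltW; apply: lt_trans (Hg k _) _; first by rewrite leq_max km1.
rewrite invf_plt ?posrE ?ltr0n//; apply: lt_le_trans (truncnS_gt _) _.
by rewrite ler_nat ltnS leq_maxr.
Unshelve. all: by end_near. Qed.

(** The sets [grid_nbhd f m] form the base of a filter that converges to f
    uniformly on compact sets, so it is finer than the neighbourhood filter. *)
Lemma grid_nbhd_open (f : conc_fun R n) (U : set (conc_fun R n)) :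
  open U -> U f -> exists m, grid_nbhd f m `<=` U.
Proof.
move=> oU Uf.
pose F : set_system (conc_fun R n) := [set A | exists m, grid_nbhd f m `<=` A].
have FF : Filter F.
  split.
  - by exists 0%N.
  - move=> A B [m Am] [m' Bm]; exists (maxn m m') => g Hg; split.
      by apply: Am; apply: grid_nbhd_anti Hg; exact: leq_maxl.
    by apply: Bm; apply: grid_nbhd_anti Hg; exact: leq_maxr.
  - by move=> A B AB [m Am]; exists m => g /Am/AB.
suff : F --> f by apply; exact: open_nbhs_nbhs.
apply/conc_fun_cvgE/fam_cvgP => K cK P /uniform_nbhs[E [/= [e e0 eE] EP]].
have [m Hm] := grid_nbhd_unif_compact f cK e0.
exists m => g /Hm Hg; apply: EP => y Ky; apply: eE; exact: Hg.
Qed.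

(** By [grid_nbhd_open] an open set is the union of the boxes it contains among
    those given by finitely many grid points and rational centers, which are
    countably many. *)
Lemma measurable_conc_fun d (T : measurableType d) (Phi : T -> conc_fun R n) :
  (forall k, measurable_fun setT (fun w => Phi w (grid_seq k) : R)) ->
  measurable_fun setT Phi.
Proof.
move=> mPhi; apply: (@measurability _ _ _ _ _ _ (@open (conc_fun R n))) => //.
move=> _ [U oU <-]; rewrite setTI.
pose box (s : seq rat) : set (conc_fun R n) := [set g | forall k, (k < size s)%N ->
  `|ratr (nth 0 s k) - g (grid_seq k)| < (2 * (size s).+1%:R)^-1].
pose V (j : nat) := if choice.unpickle j is Some s then
  if `[< box s `<=` U >] then Phi @^-1` box s else set0 else set0.
have mbox s : measurable (Phi @^-1` box s).
  rewrite (_ : _ @^-1` _ = \bigcap_(k in `I_(size s))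
    (fun w => Phi w (grid_seq k)) @^-1`
      (@ball _ R (ratr (nth 0 s k)) (2 * (size s).+1%:R)^-1)).
    apply: bigcap_measurableType => // k _; rewrite -[X in measurable X]setTI.
    by apply: mPhi => //; exact: measurable_ball.
  by apply/seteqP; split.
rewrite (_ : _ @^-1` _ = \bigcup_j V j).
  apply: bigcup_measurable => j _; rewrite /V; case: choice.unpickle => // s.
  by case: ifP.
apply/seteqP; split=> [w Uw|w [j _]]; last first.
  by rewrite /V; case: choice.unpickle => // s; case: asboolP => // sU /sU.
have [m Hm] := grid_nbhd_open oU Uw.
(* half the radius of [grid_nbhd], to leave room for a rational center *)
pose r : R := (2 * m.+1%:R)^-1.
have r0 : 0 < r by rewrite invr_gt0 mulr_gt0.
have /choice[s Hs] : forall k : nat, exists q : rat, `|ratr q - Phi w (grid_seq k)| < r.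
  move=> k; have [|q] := @rat_in_itvoo R (Phi w (grid_seq k) - r) (Phi w (grid_seq k) + r).
    by lra.
  by rewrite in_itv/= => /andP[q1 q2]; exists q; rewrite ltr_distl q1 q2.
pose s' := mkseq s m.
exists (choice.pickle s') => //; rewrite /V choice.pickleK asboolT.
  by move=> k; rewrite size_mkseq => km; rewrite nth_mkseq.
move=> g Hg; apply: Hm => k km.
have := Hg k; rewrite size_mkseq => /(_ km); rewrite nth_mkseq// => g1.
have := Hs k => g2.
have -> : m.+1%:R^-1 = r + r :> R.
  have -> : r + r = 2 * r by ring.
  by rewrite /r invfM mulVKf// pnatr_eq0.
rewrite -(subrK (ratr (s k)) (Phi w _)) -addrA.
by rewrite (le_lt_trans (ler_normD _ _))// ltrD// distrC.
Qed.

End concave_topology.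

(** * Two limits of exponentials *)

Section exponential_limit.
Context {R : realType}.

(** Squeezed by exp (- x / (1 - x)) <= 1 - x <= exp (- x), both from
    1 + y <= exp y. *)
Lemma one_minus_pow_cvg (x : nat -> R) (L : R) :
  (forall K, 0 <= x K <= 1) ->
  K.+1%:R * x K @[K --> \oo] --> L ->
  (1 - x K) ^+ K.+1 @[K --> \oo] --> expR (- L).
Proof.
move=> x01 xL.
have x0 : x K @[K --> \oo] --> 0.
  have : harmonic K * (K.+1%:R * x K) @[K --> \oo] --> 0 * L.
    by apply: cvgM => //; exact: cvg_harmonic.
  rewrite mul0r; apply: cvg_trans; apply: near_eq_cvg; apply: nearW => K.
  by rewrite mulrA /harmonic mulVf ?mul1r// pnatr_eq0.
have up : expR (- (K.+1%:R * x K)) @[K --> \oo] --> expR (- L).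
  by apply: continuous_cvg; [exact: continuous_expR|exact: cvgN].
have lo : expR (- (K.+1%:R * x K * (1 - x K)^-1)) @[K --> \oo] --> expR (- L).
  apply: continuous_cvg; first exact: continuous_expR.
  apply: cvgN; rewrite -[X in _ --> X]mulr1; apply: cvgM => //.
  rewrite -[X in _ --> X](@invr1 R); apply: cvgV; first exact: oner_neq0.
  by rewrite -[X in _ --> X]subr0; apply: cvgB => //; exact: cvg_cst.
apply: (squeeze_cvgr _ lo up).
near=> K; have /andP[xK0 xK1] := x01 K.
have xK : x K < 1.
  by near: K; exact: (cvgr_lt _ x0 1 ltr01).
have y0 : 0 < 1 - x K by rewrite subr_gt0.
apply/andP; split; last first.
  rewrite -mulrN expRM_natl lerXn2r ?nnegrE ?expR_ge0 ?(ltW y0)//.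
  exact: expR_ge1Dx.
rewrite -mulrA -mulrN expRM_natl lerXn2r ?nnegrE ?expR_ge0 ?(ltW y0)//.
rewrite expRN -[leRHS]invrK lef_pV2 ?posrE ?expR_gt0 ?invr_gt0//.
apply: le_trans (expR_ge1Dx _).
have -> : 1 + x K * (1 - x K)^-1 = (1 - x K)^-1 by field; rewrite gt_eqF.
exact: lexx.
Unshelve. all: by end_near. Qed.

Lemma expeR_cvgN (u : nat -> R) (l : \bar R) :
  (forall m, 0 <= u m) -> (u m)%:E @[m --> \oo] --> l ->
  (expR (- u m))%:E @[m --> \oo] --> expeR (- l).
Proof.
move=> u0; case: l => [r|uy|uy].
- move=> /fine_cvgP[_ ur]; apply: cvg_EFin; first exact: nearW.
  by apply: continuous_cvg; [exact: continuous_expR|exact: cvgN].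
- rewrite /=; apply: cvg_EFin; first exact: nearW.
  apply: (cvg_comp _ _ _ (@cvgr_expR R)).
  by apply/cvgeryP.
- exfalso; have /cvgeNyPle/(_ (-1))[N _ /(_ N (leqnn N))] := uy.
  by rewrite lee_fin leNgt (lt_le_trans _ (u0 N))// ltrN10.
Qed.

End exponential_limit.

(** * Continuous bumps between tail events *)

Section weak_limit_mass.
Context {R : realType}.
Variables (n : nat) (n_ge2 : (2 <= n)%N).
Variables (a : nat -> R) (m : nat).
Hypothesis a_ge0 : forall k, 0 <= a k.

Definition above (t : R) : set (conc_fun R n) :=
  [set w | forall k, (k < m)%N -> t * a k <= w (grid_seq n_ge2 k)].

Lemma measurable_eval k : measurable_fun setT
  (fun g : conc_fun R n => g (grid_seq n_ge2 k) : R).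
Proof.
apply: (measurability _ (RGenOInfty.measurableE R)) => _ [_ [x ->] <-].
rewrite setTI; apply: sub_sigma_algebra.
apply: open_comp; last exact: interval_open.
move=> f _; apply: conc_fun_eval_continuous; exact: grid_seq_simplex.
Qed.

Lemma measurable_above t : measurable (above t).
Proof.
rewrite (_ : above t = \bigcap_(k in `I_m)
  (fun g : conc_fun R n => g (grid_seq n_ge2 k) : R) @^-1` [set` `[t * a k, +oo[]).
  apply: bigcap_measurableType => // k _; rewrite -[X in measurable X]setTI.
  by apply: measurable_eval.
apply/seteqP; split=> w H k /= km; have := H k km; by rewrite /= in_itv/= andbT.
Qed.

(** A continuous function between the indicators of [above v] and [above u].
    The shape 1 - min(1, max(0, r)) makes the factor constantly 1 when a k = 0,
    in accordance with 1/0 = 0 and with the constraint being void. *)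
Definition above_bump (u v : R) (w : conc_fun R n) : R :=
  \prod_(k < m) (1 - Num.min 1 (Num.max 0
    ((v * a k - w (grid_seq n_ge2 k)) / ((v - u) * a k)))).

Lemma above_bump_continuous u v : continuous (above_bump u v).
Proof.
apply: continuous_big => [|k _ w]; first exact: mul_continuous.
set e := fun w : conc_fun R n => w (grid_seq n_ge2 k) : R.
have ce : {for w, continuous e}.
  by apply: conc_fun_eval_continuous; exact: grid_seq_simplex.
pose r y : R := 1 - Num.min 1 (Num.max 0 ((v * a k - y) / ((v - u) * a k))).
suff cr : {for e w, continuous r} by exact: (continuous_comp ce cr).
have c1 : {for e w, continuous (fun y => (v * a k - y) / ((v - u) * a k))}.
  by apply: cvgMl; apply: cvgB; [exact: cvg_cst|exact: cvg_id].
have c0 (c : R) : {for e w, continuous (fun _ : R => c)} by exact: cvg_cst.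
have c2 := continuous_min (c0 1) (continuous_max (c0 0) c1).
by apply: cvgB; [exact: cvg_cst|exact: c2].
Qed.

Lemma clamp_itv (r : R) : 0 <= 1 - Num.min 1 (Num.max 0 r) <= 1.
Proof.
rewrite subr_ge0 ge_min lexx/= gerBl le_min ler01 le_max lexx//.
Qed.

Lemma above_bump_itv u v w : 0 <= above_bump u v w <= 1.
Proof.
rewrite /above_bump; elim/big_ind : _ => [|x y /andP[x0 x1] /andP[y0 y1]|k _].
- by rewrite ler01 lexx.
- by rewrite mulr_ge0//= mulr_ile1.
- exact: clamp_itv.
Qed.

Lemma above_bump1 u v w : u < v -> above v w -> above_bump u v w = 1.
Proof.
move=> uv Hw; apply: big1 => k _.
rewrite max_l ?min_r ?subr0//.
apply: mulr_le0_ge0; first by rewrite subr_le0 Hw.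
by rewrite invr_ge0 mulr_ge0// subr_ge0 ltW.
Qed.

Lemma above_bump0 u v w : u < v -> ~ above u w -> above_bump u v w = 0.
Proof.
move=> uv /existsNP[k /not_implyP[km /negP]]; rewrite -ltNge => H.
have wk := conc_fun_ge0 w (grid_seq n_ge2 k).
have ak : 0 < a k.
  rewrite lt_neqAle a_ge0 andbT; apply/eqP => ak; move: H.
  by rewrite -ak mulr0 ltNge wk.
rewrite /above_bump (bigD1 (Ordinal km))//= (min_l (x := 1)) ?subrr ?mul0r//.
rewrite le_max; apply/orP; right.
rewrite ler_pdivlMr ?mulr_gt0 ?subr_gt0// mul1r mulrBl lerD2l lerN2.
exact: ltW.
Qed.

Lemma above_bump_bounds u v (nu : {measure set (conc_fun R n) -> \bar R}) :
  u < v ->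
  (nu (above v) <= \int[nu]_w (above_bump u v w)%:E /\
   \int[nu]_w (above_bump u v w)%:E <= nu (above u))%E.
Proof.
move=> uv.
have mb : measurable_fun setT (EFin \o above_bump u v).
  apply/measurable_EFinP; apply: measurable_prod => k _.
  apply: measurable_funB => //; apply: measurable_minr => //.
  apply: measurable_maxr => //; apply: measurable_funM => //.
  by apply: measurable_funB => //; exact: measurable_eval.
have b0 w : (0 <= (above_bump u v w)%:E)%E.
  by rewrite lee_fin; have /andP[] := above_bump_itv u v w.
split.
  rewrite -[X in nu X]setIT -integral_indic//; last exact: measurable_above.
  apply: ge0_le_integral => //.
  - by apply/measurable_EFinP; apply: measurable_indic; exact: measurable_above.
  - move=> w _; rewrite lee_fin indicE.
    case: (boolP (w \in above v)) => [/set_mem Hw|_]; last first.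
      by have /andP[] := above_bump_itv u v w.
    by rewrite above_bump1.
rewrite -[X in nu X]setIT -integral_indic//; last exact: measurable_above.
apply: ge0_le_integral => //.
- by apply/measurable_EFinP; apply: measurable_indic; exact: measurable_above.
- move=> w _; rewrite lee_fin indicE.
  case: (boolP (w \in above u)) => [_|/negP nw].
    by have /andP[] := above_bump_itv u v w.
  by rewrite above_bump0// => Hw; apply: nw; exact: mem_set.
Qed.

End weak_limit_mass.

(** * The tail of the limit law *)

Section tail_probability.
Variables (R : realType) (n : nat) (n_ge2 : (2 <= n)%N).
Variables (d0 : measure_display) (Omega0 : measurableType d0).
Variables (P0 : probability Omega0 R) (C : {RV P0 >-> 'rV[R]_n}).
Hypothesis C_gt0 : forall w, Rplus n (C w).
Variables (d : measure_display) (Omega : measurableType d) (P : probability Omega R).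
Variable ell : nat -> {RV P >-> conc_fun R n}.
Hypothesis ell_copies : forall k (A : set (conc_fun R n)), measurable A ->
  distribution P (ell k) A = pushforward P0 (fun w => conc_linear (C_gt0 w)) A.
Hypothesis ell_independent : independent_RVs ell.

Local Notation grid := (grid_seq n_ge2).
Local Notation q := (fun k => \val (grid k) : 'rV[R]_n).

Section finitely_many.
Variables (a : nat -> R) (m : nat).
Hypothesis a_ge0 : forall k, 0 <= a k.

Lemma ell_above k t :
  P (ell k @^-1` above n_ge2 a m t) = (1 - cut_prob q a m C t)%:E.
Proof.
transitivity (distribution P (ell k) (above n_ge2 a m t)); first by [].
rewrite ell_copies; last exact: measurable_above.
rewrite /pushforward (_ : _ @^-1` _ = ~` (C @^-1` cut q a m t)).
  rewrite probability_setC; last by apply: measurable_preC; exact: measurable_cut.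
  by rewrite cut_probE.
apply/seteqP; split=> w /=.
  move=> H [_ [j jm]]; rewrite ltNge => /negP; apply; exact: (H j jm).
move=> H j jm; rewrite /conc_fun_apply/= leNgt; apply/negP => H'; apply: H.
by split=> //; exists j.
Qed.

Lemma scaled_min_above s K t (w : Omega) : 0 < t ->
  above n_ge2 a m t (scaled_min s (fun k => ell k w) K.+1) <->
  forall k, (k < K.+1)%N -> above n_ge2 a m (t * K.+1%:R `^ (- s)) (ell k w).
Proof.
move=> t0; have Ks : 0 < K.+1%:R `^ s :> R by rewrite powR_gt0.
have E j (x : R) : (t * a j <= K.+1%:R `^ s * x) =
    (t * K.+1%:R `^ (- s) * a j <= x).
  by rewrite powRN mulrAC ler_pdivrMr// mulrC [x * _]mulrC.
split=> H.
  move=> k kK j jm; have := H j jm; rewrite scaled_minE E => /le_trans; apply.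
  by rewrite (bigD1 (Ordinal kK))//= ge_min lexx.
move=> j jm; rewrite scaled_minE E.
elim/big_ind : _ => [|x y xj yj|k _]; first exact: H.
  by rewrite le_min xj yj.
exact: H.
Qed.

Lemma scaled_min_above_prob s K t : 0 < t ->
  P ((fun w => scaled_min s (fun k => ell k w) K.+1) @^-1` above n_ge2 a m t) =
  ((1 - cut_prob q a m C (t * K.+1%:R `^ (- s))) ^+ K.+1)%:E.
Proof.
move=> t0; set J := [fset k | k in iota 0 K.+1]%fset.
have Jperm : perm_eq J (iota 0 K.+1).
  apply: uniq_perm; [exact: fset_uniq|exact: iota_uniq|].
  by move=> k; rewrite !inE.
rewrite (_ : _ @^-1` _ = \bigcap_(k in [set` J])
    (ell k @^-1` above n_ge2 a m (t * K.+1%:R `^ (- s)))).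
  rewrite ell_independent; last by move=> k; exact: measurable_above.
  under eq_bigr do rewrite ell_above.
  rewrite prodEFin (perm_big _ Jperm) big_const_seq count_predT size_iota.
  by rewrite iter_mulr_1.
apply/seteqP; split=> w.
  move=> /(scaled_min_above _ _ _ t0) H k /=.
  by rewrite (perm_mem Jperm) mem_iota add0n => /andP[_ /H].
move=> H; apply/(scaled_min_above _ _ _ t0) => k kK; apply: H => /=.
by rewrite (perm_mem Jperm) mem_iota add0n.
Qed.

End finitely_many.

Lemma measurable_scaled_min s K : measurable_fun setT
  (fun w => scaled_min s (fun k => ell k w) K.+1).
Proof.
apply: (@measurable_conc_fun R n n_ge2 _ Omega
  (fun w => scaled_min s (fun k => ell k w) K.+1)) => j.
under eq_fun do rewrite scaled_minE.
apply: measurable_funM => //.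
have mE k : measurable_fun setT (fun w => (ell k w : conc_fun R n) (grid j) : R).
  apply: (measurableT_comp (measurable_eval n_ge2 j)).
  exact: measurable_funPT.
elim: (index_enum _) => [|k r IH].
  by under eq_fun do rewrite big_nil; exact: mE.
by under eq_fun do rewrite big_cons; exact: measurable_minr.
Qed.

Variables (alpha : R) (h : 'rV[R]_n -> R).
Hypothesis C_homogeneous : asymptotically_homogeneous C alpha h.
Variable mu : probability (conc_fun R n) R.
Hypothesis mu_limit : weak_limit
  (fun K => pushforward P
    (fun w => scaled_min (n%:R + alpha)^-1 (fun k => ell k w) K)) mu.

Lemma index_gt0 : 0 < n%:R + alpha.
Proof.
have [rho [Cd [mh h0] hpos hcvg hunif]] := C_homogeneous.
apply: (@exponent_gt0 R n n_ge2 q (fun=> 1) 1%N _ _ _ _ P0 C alpha h rho) => //.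
  by move=> k; exact: grid_seq_simplex.
by exists 0%N.
Qed.

Section finitely_many_limit.
Variables (a : nat -> R) (m : nat).
Hypothesis a_ge0 : forall k, 0 <= a k.

(** With kappa = t K^(-1/b) and b = n + alpha one has K = t^b kappa^(-b), so K
    times the probability of a single hit tends to t^b L. *)
Lemma scaled_min_above_cvg (L : R) t : 0 < t ->
  k `^ (- (n%:R + alpha)) * cut_prob q a m C k @[k --> 0^'+] --> L ->
  (1 - cut_prob q a m C (t * K.+1%:R `^ (- (n%:R + alpha)^-1))) ^+ K.+1
    @[K --> \oo] --> expR (- (t `^ (n%:R + alpha) * L)).
Proof.
move=> t0 Lcvg; set b := n%:R + alpha; have b0 : 0 < b := index_gt0.
apply: one_minus_pow_cvg => [K|].
  rewrite cut_prob_ge0/= cut_prob_le1//.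
pose u (K : nat) : R := t * K.+1%:R `^ (- b^-1).
have u0 K : 0 < u K by rewrite mulr_gt0// powR_gt0.
have ucvg : u K @[K --> \oo] --> 0.
  rewrite -[X in _ --> X](mulr0 t); apply: cvgMr.
  have : harmonic K `^ b^-1 @[K --> \oo] --> (0 : R).
    apply: (@cvg_right_seq R (fun x => x `^ b^-1)).
    - exact: harmonic_gt0.
    - exact: cvg_harmonic.
    - by apply: powR_cvg0; rewrite invr_gt0.
  apply: cvg_trans; apply: near_eq_cvg; apply: nearW => K.
  by rewrite /harmonic/= -(@powR_inv1 R K.+1%:R) ?ler0n// -powRrM mulN1r.
have := cvg_right_seq u0 ucvg Lcvg.
move=> H; have : t `^ b * (u K `^ (- b) * cut_prob q a m C (u K)) @[K --> \oo] -->
    t `^ b * L by exact: cvgMr.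
apply: cvg_trans; apply: near_eq_cvg; apply: nearW => K /=.
rewrite mulrA; congr (_ * _).
rewrite /u powRM ?powR_ge0 ?ltW// mulrA -powRD; last first.
  by apply/implyP => _; rewrite gt_eqF.
by rewrite subrr powRr0 mul1r -powRrM mulrNN mulVf ?gt_eqF// powRr1.
Qed.

Lemma mu_above_bounds (L u v : R) : 0 < u -> u < v ->
  k `^ (- (n%:R + alpha)) * cut_prob q a m C k @[k --> 0^'+] --> L ->
  (mu (above n_ge2 a m v) <= (expR (- (u `^ (n%:R + alpha) * L)))%:E)%E /\
  ((expR (- (v `^ (n%:R + alpha) * L)))%:E <= mu (above n_ge2 a m u))%E.
Proof.
move=> u0 uv Lcvg; have v0 := lt_trans u0 uv.
have fc := @above_bump_continuous R n n_ge2 a m u v.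
have fb : exists M, forall w, `|above_bump n_ge2 a m u v w| <= M.
  exists 1 => w; have /andP[w0 w1] := above_bump_itv n_ge2 a m u v w.
  by rewrite ger0_norm.
have := mu_limit fc fb; set I := fun K : nat => _; set J := integral mu _ _.
move=> IJ.
(* shifted since [scaled_min] is a minimum of K functions only for 0 < K *)
have {}IJ : I K.+1 @[K --> \oo] --> J.
  by move=> /= B /IJ[N _ HN]; exists N => // K /= NK; apply: HN; exact: leqW.
have [mu1 mu2] := @above_bump_bounds R n n_ge2 a m a_ge0 u v mu uv.
pose s := (n%:R + alpha)^-1.
have IE K : (((1 - cut_prob q a m C (v * K.+1%:R `^ (- s))) ^+ K.+1)%:E <= I K.+1 /\
    I K.+1 <= ((1 - cut_prob q a m C (u * K.+1%:R `^ (- s))) ^+ K.+1)%:E)%E.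
  have pE r : 0 < r -> push_measure P (measurable_scaled_min s K) (above n_ge2 a m r) =
      ((1 - cut_prob q a m C (r * K.+1%:R `^ (- s))) ^+ K.+1)%:E.
    by move=> r0; exact: scaled_min_above_prob.
  have := @above_bump_bounds R n n_ge2 a m a_ge0 u v
    (push_measure P (measurable_scaled_min s K)) uv.
  by rewrite !pE.
have cmp (f g : nat -> \bar R) lf lg : (forall K, f K <= g K)%E ->
    f K @[K --> \oo] --> lf -> g K @[K --> \oo] --> lg -> (lf <= lg)%E.
  move=> fg cf cg; rewrite -(cvg_lim _ cf)// -(cvg_lim _ cg)//.
  by apply: lee_lim; [apply/cvg_ex; exists lf|apply/cvg_ex; exists lg|exact: nearW].
split.
  apply: (le_trans mu1); apply: (cmp _ _ _ _ (fun K => (IE K).2) IJ).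
  by apply: cvg_EFin; [exact: nearW|exact: scaled_min_above_cvg].
apply: le_trans _ mu2; apply: (cmp _ _ _ _ (fun K => (IE K).1) _ IJ).
by apply: cvg_EFin; [exact: nearW|exact: scaled_min_above_cvg].
Qed.

(** The two bounds of [mu_above_bounds] around 1 pinch the mass, by continuity
    of y |-> exp (- y L) at y = 1. *)
Lemma mu_above (L : R) :
  k `^ (- (n%:R + alpha)) * cut_prob q a m C k @[k --> 0^'+] --> L ->
  mu (above n_ge2 a m 1) = (expR (- L))%:E.
Proof.
move=> Lcvg; set b := n%:R + alpha; have b0 : 0 < b := index_gt0.
have /fineK muE : mu (above n_ge2 a m 1) \is a fin_num.
  by rewrite fin_num_measure//; exact: measurable_above.
rewrite -muE; congr (_%:E); set x := fine _ in muE *.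
(* for u = y^(1/b) the bound exp (- u^b L) becomes exp (- y L) *)
have rootK y : 0 < y -> (y `^ b^-1) `^ b = y.
  by move=> y0; rewrite -powRrM mulVf ?gt_eqF// powRr1 ?ltW.
have cE : expR (- (y * L)) @[y --> (1 : R)] --> expR (- L).
  apply: continuous_cvg; first exact: continuous_expR.
  by apply: cvgN; rewrite -[X in _ --> X]mul1r; apply: cvgMl; exact: cvg_id.
apply/eqP; rewrite eq_le; apply/andP; split; rewrite leNgt; apply/negP => xL.
  have [e /= e0 He] := cvgr_lt _ cE _ xL.
  pose y := 1 - Num.min (e / 2) 2^-1.
  have yb : 0 < y < 1.
    rewrite /y subr_gt0 gt_min gtrBl lt_min divr_gt0//= invr_gt0 ltr0n andbT.
    by rewrite invf_lt1// ltr1n orbT.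
  have /andP[y0 y1] := yb.
  have u1 : y `^ b^-1 < 1.
    have E1 : 1 = 1 `^ b^-1 :> R by rewrite powR1.
    by rewrite [ltRHS]E1 gt0_ltr_powR ?invr_gt0// nnegrE ltW.
  have [+ _] := mu_above_bounds (powR_gt0 b^-1 y0) u1 Lcvg.
  rewrite -/b rootK// -muE lee_fin leNgt => /negP; apply; apply: He => /=.
  rewrite /y opprB addrC subrK ger0_norm ?le_min ?divr_ge0 ?ltW//.
  by rewrite gt_min ltr_pdivrMr// ltr_pMr// ltr1n.
have [e /= e0 He] := cvgr_gt _ cE _ xL.
pose y := 1 + e / 2; have e20 : 0 < e / 2 by rewrite divr_gt0.
have y1 : 1 < y by rewrite ltrDl.
have y0 : 0 < y := lt_trans ltr01 y1.
have u1 : 1 < y `^ b^-1.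
  have E1 : 1 = 1 `^ b^-1 :> R by rewrite powR1.
  by rewrite [ltLHS]E1 gt0_ltr_powR ?invr_gt0// nnegrE ltW.
have [_] := mu_above_bounds ltr01 u1 Lcvg.
rewrite -/b rootK// -muE lee_fin leNgt => /negP; apply; apply: He => /=.
rewrite /y opprD addrA subrr sub0r normrN ger0_norm ?ltW//.
by rewrite ltr_pdivrMr// ltr_pMr// ltr1n.
Qed.

End finitely_many_limit.

Variable psi : conc_fun R n.
Local Notation a := (fun k => psi (grid k) : R).

(** Close grid points transfer the inequality to the open simplex by
    [concave_lower]; continuity extends it to the boundary. *)
Lemma tail_above : [set w : conc_fun R n | forall p, psi p <= w p] =
  \bigcap_m above n_ge2 a m 1.
Proof.
apply/seteqP; split=> w H.
  by move=> m _ k _; rewrite mul1r; exact: H.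
have Hgrid k : psi (grid k) <= w (grid k).
  by have := H k.+1 I k (ltnSn k); rewrite mul1r.
have Hopen p : simplex n (\val p) -> psi p <= w p.
  move=> sp; apply/ler_addgt0Pl => e e0.
  have [M M0 psiM] := concave_bounded n_ge2 psi.
  pose t := Num.min 2^-1 (e / (2 * M)).
  have t0 : 0 < t by rewrite lt_min invr_gt0 ltr0n/= divr_gt0// mulr_gt0.
  have t2 : t <= 2^-1 by rewrite ge_min lexx.
  have t1 : t < 1 by lra.
  have tM : 2 * M * t <= e by rewrite mulrC -ler_pdivlMr ?mulr_gt0// ge_min lexx orbT.
  have t01 : 0 < t < 1 by rewrite t0.
  have [k Hk] := grid_seq_dense n_ge2 sp t01.
  have t01' : 0 < t <= 1 by rewrite t0 ltW.
  have h1 := concave_lower n_ge2 psi t01' (fun i => (Hk i).1).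
  have h2 := concave_lower n_ge2 w t01' (fun i => (Hk i).2).
  have h3 := Hgrid k; have h4 := psiM p; have h5 := conc_fun_ge0 psi p.
  have h6 : (1 - t) * ((1 - t) * psi p) <= (1 - t) * w (grid k).
    by rewrite ler_pM2l ?subr_gt0// (le_trans h1).
  have h7 : t * psi p <= t * M by rewrite ler_pM2l.
  have h8 : 0 <= t * (t * psi p) by rewrite !mulr_ge0// ltW.
  by nra.
move=> p; rewrite leNgt; apply/negP => wp.
have cw := @conc_fun_continuous R n w; have cpsi := @conc_fun_continuous R n psi.
have cd : continuous (fun x : @closed_simplex R n => w x - psi x : R).
  by move=> x; exact: (cvgB (cw x) (cpsi x)).
have oU : open [set x : @closed_simplex R n | w x - psi x < 0].
  apply: (@open_comp _ _ (fun x => w x - psi x) [set y : R | y < 0]); last exact: open_lt.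
  by move=> x _; exact: cd.
have [|r] := closed_simplex_dense (p := p) oU; first by rewrite /= subr_lt0.
by rewrite /= subr_lt0 ltNge => /negP nr /Hopen.
Qed.

(** If <p, x> < psi p strictly, a grid point close enough to p also satisfies
    the inequality. *)
Lemma Rhat_cut : Rhat psi = \bigcup_m cut q a m 1.
Proof.
apply/seteqP; split=> x; last first.
  move=> [m _ [x0 [k km H]]]; exists (grid k); first exact: grid_seq_simplex.
  by split=> //; rewrite mul1r in H.
move=> [p /= sp [x0 xp]].
have dx (y : 'rV[R]_n) : (forall i, 0 <= y 0 i) -> 0 <= dotp y x.
  by move=> y0; apply: sumr_ge0 => i _; rewrite mulr_ge0// ltW.
have p0 i : 0 <= \val p 0 i by have [/(_ i)/andP[/ltW]] := sp.
have psi0 : 0 < psi p by apply: le_lt_trans xp; exact: dx.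
pose t := Num.min 2^-1 ((psi p - dotp (\val p) x) / (4 * psi p)).
have t0 : 0 < t.
  by rewrite lt_min invr_gt0 ltr0n/= divr_gt0 ?subr_gt0// mulr_gt0.
have t2 : t <= 2^-1 by rewrite ge_min lexx.
have t4 : t * (4 * psi p) <= psi p - dotp (\val p) x.
  by rewrite -ler_pdivlMr ?mulr_gt0// ge_min lexx orbT.
have t1 : t < 1 by lra.
have t01 : 0 < t < 1 by rewrite t0.
have t01' : 0 < t <= 1 by rewrite t0 ltW.
have [k Hk] := grid_seq_dense n_ge2 sp t01.
have h1 := concave_lower n_ge2 psi t01' (fun i => (Hk i).1).
have h2 : (1 - t) * dotp (\val (grid k)) x <= dotp (\val p) x.
  rewrite /dotp mulr_sumr; apply: ler_sum => i _; rewrite mulrA ler_wpM2r ?(ltW (x0 i))//.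
  exact: (Hk i).2.
exists k.+1 => //; split=> //; exists k => //; rewrite mul1r.
have s0 : 0 < 1 - t by rewrite subr_gt0.
rewrite -(ltr_pM2l s0); apply: le_lt_trans h2 _.
apply: (@lt_le_trans _ _ ((1 - t) * ((1 - t) * psi p))); last by rewrite ler_pM2l.
have : 0 < t * (t * psi p) by rewrite !mulr_gt0.
by nra.
Qed.

Lemma tail_probE :
  tail_prob mu psi = expeR (- \int[lebesgue_rV n]_(x in Rhat psi) (h x)%:E)%E.
Proof.
have a0 k : 0 <= psi (grid k) := conc_fun_ge0 _ _.
have [rho [Cd [mh h0] hpos hcvg hunif]] := C_homogeneous.
have cutE m : exists2 L : R,
    (\int[lebesgue_rV n]_(x in cut q a m 1) (h x)%:E = L%:E)%E &
    mu (above n_ge2 a m 1) = (expR (- L))%:E.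
  have [||||||||L LE Lcvg] := @cut_prob_cvg R n n_ge2 q a m _ _ _ _ P0 C alpha h rho => //.
  - by move=> k; exact: grid_seq_simplex.
  - exact: index_gt0.
  by exists L => //; apply: mu_above.
have /choice[L HL] : forall m, exists L : R,
    (\int[lebesgue_rV n]_(x in cut q a m 1) (h x)%:E = L%:E)%E /\
    mu (above n_ge2 a m 1) = (expR (- L))%:E.
  by move=> m; have [L] := cutE m; exists L.
have L0 m : 0 <= L m.
  rewrite -lee_fin -(HL m).1 integral_ge0// => x [x0 _].
  by rewrite lee_fin h0.
have Lcvg : (L m)%:E @[m --> \oo] -->
    (\int[lebesgue_rV n]_(x in Rhat psi) (h x)%:E)%E.
  rewrite Rhat_cut; under eq_fun do rewrite -(HL _).1.
  apply: ge0_nondecreasing_set_cvg_integral.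
  - move=> i j ij; apply/subsetPset => x [x0 [k ki H]]; split=> //.
    by exists k => //; exact: leq_trans ij.
  - by move=> m; exact: measurable_cut.
  - move=> m; apply/measurable_EFinP; apply: measurable_funS mh => //.
      exact: measurable_Rplus.
    exact: cut_Rplus.
  - by move=> m x [x0 _]; rewrite lee_fin h0.
have mucvg : mu (above n_ge2 a m 1) @[m --> \oo] --> tail_prob mu psi.
  rewrite /tail_prob tail_above; apply: nonincreasing_cvg_mu.
  - by rewrite (le_lt_trans (probability_le1 _ _)) ?ltry//; exact: measurable_above.
  - by move=> m; exact: measurable_above.
  - by apply: bigcapT_measurable => m; exact: measurable_above.
  - move=> i j ij; apply/subsetPset => w H k ki; apply: H.
    exact: leq_trans ij.
have := expeR_cvgN L0 Lcvg; move: mucvg; under eq_fun do rewrite (HL _).2.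
exact: cvg_unique.
Qed.

End tail_probability.

Theorem theorem3p12 (R : realType) (n : nat) (n_ge2 : (2 <= n)%N)
  (d0 : measure_display) (Omega0 : measurableType d0)
  (P0 : probability Omega0 R) (C : {RV P0 >-> 'rV[R]_n})
  (C_gt0 : forall w, Rplus n (C w))
  (alpha : R) (h : 'rV[R]_n -> R)
  (C_homogeneous : asymptotically_homogeneous C alpha h)
  (d : measure_display) (Omega : measurableType d) (P : probability Omega R)
  (ell : nat -> {RV P >-> conc_fun R n})
  (ell_copies : forall k (A : set (conc_fun R n)), measurable A ->
    distribution P (ell k) A = pushforward P0 (fun w => conc_linear (C_gt0 w)) A)
  (ell_independent : independent_RVs ell)
  (mu : probability (conc_fun R n) R)
  (mu_limit : weak_limit
    (fun K => pushforward P
      (fun w => scaled_min (n%:R + alpha)^-1 (fun k => ell k w) K)) mu)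
  (psi : conc_fun R n) :
  tail_prob mu psi =
    expeR (- \int[lebesgue_rV n]_(x in Rhat psi) (h x)%:E)%E.
Proof.
exact: (tail_probE n_ge2 ell_copies ell_independent C_homogeneous mu_limit psi).
Qed.
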